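(* Let $(\mathcal M,\otimes,\mathbb I)$ be a symmetric monoidal abelian, locally small and bicomplete category whose tensor product functors are right exact. Let $(A,m,u)$ be an Azumaya monoid in $\mathcal M$ such that $A$ has a left internal hom functor and $A\otimes A\,|\,A$. Assume that the functor $\mathcal Z=\mathrm{Hom}_{\mathcal M}(\mathbb I,-)$ is faithful. Then $\mathcal G_{\mathcal Z(\mathbb I)}(\mathcal Z(A))=\mathcal H_{\mathcal Z(\mathbb I)}(\mathcal Z(A))$, and the group homomorphisms $$\Gamma:\mathrm{Inv}_{\mathbb I}(A)\to\mathrm{Aut}_{alg}(A),\quad \omega:\mathrm{Aut}_{alg}(A)\to\mathcal G_{\mathcal Z(\mathbb I)}(\mathcal Z(A)),\ \gamma\mapsto\mathcal Z(\gamma),$$ are bijective. Moreover, the following is a commutative diagram of group homomorphisms: $\widehat\Phi:\mathrm{Inv}_{\mathbb I}(A)\to\mathcal G_{\mathcal Z(\mathbb I)}(\mathcal Z(A))$, $X\mapsto\Phi_X$, is an isomorphism; $\Omega:\mathrm{Aut}_{alg}(A)\to\mathrm{Aut}_{\mathcal Z(\mathbb I)\text{-alg}}(\mathcal Z(A))$, $\gamma\mapsto\mathcal Z(\gamma)$, is injective; and with $\varsigma:\mathcal G_{\mathcal Z(\mathbb I)}(\mathcal Z(A))\hookrightarrow\mathrm{Aut}_{\mathcal Z(\mathbb I)\text{-alg}}(\mathcal Z(A))$ the inclusion and $\Phi:\mathrm{Inv}_{\mathbb I}(A)\to\mathrm{Aut}_{\mathcal Z(\mathbb I)\text{-alg}}(\mathcal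 Z(A))$, $X\mapsto\Phi_X$, one has $\Omega\circ\Gamma=\Phi=\varsigma\circ\widehat\Phi$, $\varsigma\circ\omega=\Omega$ and $\omega\circ\Gamma=\widehat\Phi$.
   Context: Associativity constraints are suppressed; $l,r$ are the unit constraints and $\tau$ is the symmetry. Locally small means that the subobjects of any object form a set. $\mathcal Z(-):=\mathrm{Hom}_{\mathcal M}(\mathbb I,-)$; $\mathcal Z(A)$ is a $\mathcal Z(\mathbb I)$-algebra with product $z*w=m\circ(z\otimes w)\circ l_{\mathbb I}^{-1}$ and unit $u$. $\mathrm{Aut}_{alg}(A)$ is the group of automorphisms of the monoid $A$; $\mathcal Z(\gamma)(z)=\gamma\circ z$. Azumaya. $A^e:=A\otimes A^o$ with $A^o$ the opposite monoid; $A$-bimodules are identified with left $A^e$-modules, forming the category ${}_{A^e}\mathcal M$. $A$ is an Azumaya monoid if $A\otimes-:\mathcal M\to{}_{A^e}\mathcal M$ is an equivalence of categories and $m:A\otimes A\to A$ splits as a morphism of $A$-bimodules. $A$ has a left internal hom functor if $A\otimes-:\mathcal M\to\mathcal M$ has a right adjoint. Divisibility. For $A$-bimodules $M,N$, $M|N$ means there are $k\ge1$ and $A$-bimodule morphisms $f_i:M\to N$, $g_i:N\to M$ with $\sum_{i=1}^k g_i\circ f_i=\mathrm{Id}_M$ ($A\otimes A$ is a bimodule via the outer sides). For $z\in\mathcal Z(A)$, $f:M\to A$ in $\mathcal M$ put $z\triangleright f:=m\circ(z\otimes f)\circ l_M^{-1}$, $f\triangleleft z:=m\circ(f\otimes z)\circ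 r_M^{-1}$; $A$ also denotes $\mathrm{Id}_A$. For $\mathcal Z(\mathbb I)$-linear $\sigma,\tau':\mathcal Z(A)\to\mathcal Z(A)$ let $\mathcal M_{A,\mathcal Z(A)}(A_\sigma,A_{\tau'})$ be the set of left $A$-linear $f:A\to A$ with $f\circ(A\triangleleft\sigma(z))=f\triangleleft\tau'(z)$ for all $z\in\mathcal Z(A)$. $A_\sigma|A_{\tau'}$ means there are $k\ge1$, $f_i\in\mathcal M_{A,\mathcal Z(A)}(A_\sigma,A_{\tau'})$, $g_i\in\mathcal M_{A,\mathcal Z(A)}(A_{\tau'},A_\sigma)$ with $\sum_i g_i\circ f_i=\mathrm{Id}_A$; $A_\sigma\sim A_{\tau'}$ means both $A_\sigma|A_{\tau'}$ and $A_{\tau'}|A_\sigma$. A subscript $1$ means the identity map. $\mathcal H_{\mathcal Z(\mathbb I)}(\mathcal Z(A)):=\{\theta\in\mathrm{Aut}_{\mathcal Z(\mathbb I)\text{-alg}}(\mathcal Z(A)): A_\theta\sim A_1\}$. The objects $J$. For $\mathcal Z(\mathbb I)$-linear $\sigma,\delta:\mathcal Z(A)\to\mathcal Z(A)$, ${}_\sigma J_\delta$ is the subobject $\bigcap_{t\in\mathcal Z(A)}\mathrm{Eq}(\sigma(t)\triangleright A,A\triangleleft\delta(t))$ of $A$, with inclusion $\mathfrak{eq}_{\sigma,\delta}$. There are unique $m_{\sigma,\gamma}^{\delta}:{}_\sigma J_\delta\otimes{}_\delta J_\gamma\to{}_\sigma J_\gamma$ with $\mathfrak{eq}_{\sigma,\gamma}\circ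 m_{\sigma,\gamma}^\delta=m\circ(\mathfrak{eq}_{\sigma,\delta}\otimes\mathfrak{eq}_{\delta,\gamma})$; these (and the factorization of $u$) make ${}_\sigma J_\sigma$ a monoid, ${}_\sigma J_\delta$ a $({}_\sigma J_\sigma,{}_\delta J_\delta)$-bimodule, and induce $\overline m^\delta_{\sigma,\gamma}:{}_\sigma J_\delta\otimes_{{}_\delta J_\delta}{}_\delta J_\gamma\to{}_\sigma J_\gamma$. For an automorphism $\theta$ one has ${}_\theta J_\theta={}_1J_1$. $\mathcal G_{\mathcal Z(\mathbb I)}(\mathcal Z(A))$ is the set of $\theta\in\mathrm{Aut}_{\mathcal Z(\mathbb I)\text{-alg}}(\mathcal Z(A))$ such that $\overline m^1_{\theta,\theta}:{}_\theta J_1\otimes_{{}_1J_1}{}_1J_\theta\to{}_1J_1$ and $\overline m^\theta_{1,1}:{}_1J_\theta\otimes_{{}_\theta J_\theta}{}_\theta J_1\to{}_1J_1$ are isomorphisms. Invertible subobjects. $\mathrm{Inv}_{\mathbb I}(A)$ is the set of subobjects $(X,i_X:X\to A)$ of $A$ for which there are a subobject $(Y,i_Y)$ of $A$ and isomorphisms $m_X:X\otimes Y\to\mathbb I$, $m_Y:Y\otimes X\to\mathbb I$ with $u\circ m_X=m\circ(i_X\otimes i_Y)$, $u\circ m_Y=m\circ(i_Y\otimes i_X)$ ($Y$ is unique as a subobject). When $u$ is a monomorphism (as is the case for such Azumaya monoids) it is a group under $(X,i_X)\cdot(X',i_{X'})=(X\otimes X',m\circ(i_X\otimes i_{X'}))$.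 For such $X$, $Y$ and $t\in\mathcal Z(A)$: $\Phi_X(t):=m\circ(i_X\otimes(t\triangleright i_Y))\circ m_X^{-1}$, and $\Gamma_X:A\to A$ is the composite $A\xrightarrow{(A\otimes m_X^{-1})\circ r_A^{-1}}A\otimes X\otimes Y\xrightarrow{\tau_{A,X}\otimes Y}X\otimes A\otimes Y\xrightarrow{i_X\otimes A\otimes i_Y}A\otimes A\otimes A\xrightarrow{m\circ(A\otimes m)}A$; $\Phi:X\mapsto\Phi_X$ and $\Gamma:X\mapsto\Gamma_X$. *)

(* Defs.v *)
From mathcomp Require Import all_boot.
From Stdlib Require Import ClassicalEpsilon ProofIrrelevance.
Set Implicit Arguments.
Unset Strict Implicit.
Unset Printing Implicit Defensive.
#[local] Obligation Tactic := by [] || idtac.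

Declare Scope cat_scope.
Delimit Scope cat_scope with cat.
Local Open Scope cat_scope.

(* The universe of "sets".  Using one fixed name for it forces hom-sets and
   the index sets of limits and of families of subobjects to have the same
   size, while [ob C] may live in a larger universe. *)
Definition small := Type.

Record category := Category {
  ob :> Type;
  hom : ob -> ob -> small;
  idm : forall X, hom X X;
  comp : forall X Y Z, hom Y Z -> hom X Y -> hom X Z;
  comp1m : forall X Y (f : hom X Y), comp (idm Y) f = f;
  compm1 : forall X Y (f : hom X Y), comp f (idm X) = f;
  compA : forall X Y Z W (h : hom Z W) (g : hom Y Z) (f : hom X Y),
    comp h (comp g f) = comp (comp h g) f }.
Arguments hom {c} X Y : rename.
Arguments idm {c} X : rename.
Arguments comp {c X Y Z} g f : rename.

Notation "g ∘ f" := (comp g f) (at level 40, left associativity) : cat_scope.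

Definition is_iso (C : category) (X Y : C) (f : hom X Y) : Prop :=
  exists g : hom Y X, g ∘ f = idm X /\ f ∘ g = idm Y.

Definition is_mono (C : category) (X Y : C) (f : hom X Y) : Prop :=
  forall (T : C) (a b : hom T X), f ∘ a = f ∘ b -> a = b.

Definition is_epi (C : category) (X Y : C) (f : hom X Y) : Prop :=
  forall (T : C) (a b : hom Y T), a ∘ f = b ∘ f -> a = b.

Definition is_equalizer (C : category) (X Y E : C) (f g : hom X Y)
    (e : hom E X) : Prop :=
  f ∘ e = g ∘ e /\
  forall (T : C) (a : hom T X), f ∘ a = g ∘ a ->
    exists! b : hom T E, e ∘ b = a.

Definition is_coequalizer (C : category) (X Y Q : C) (f g : hom X Y)
    (q : hom Y Q) : Prop :=
  q ∘ f = q ∘ g /\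
  forall (T : C) (a : hom Y T), a ∘ f = a ∘ g ->
    exists! b : hom Q T, b ∘ q = a.

Record functor (C D : category) := Functor {
  fob :> C -> D;
  fmap : forall X Y : C, hom X Y -> hom (fob X) (fob Y);
  fmap1 : forall X, fmap (idm X) = idm (fob X);
  fmapM : forall X Y Z (g : hom Y Z) (f : hom X Y),
    fmap (g ∘ f) = fmap g ∘ fmap f }.
Arguments fmap {C D} f {X Y} _ : rename.

Program Definition id_functor (C : category) : functor C C :=
  @Functor C C (fun X => X) (fun X Y f => f) _ _.

Program Definition comp_functor (C D E : category)
    (G : functor D E) (F : functor C D) : functor C E :=
  @Functor C E (fun X => G (F X)) (fun X Y f => fmap G (fmap F f)) _ _.
Next Obligation. by move=> C D E G F X /=; rewrite !fmap1. Qed.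
Next Obligation. by move=> C D E G F X Y Z g f /=; rewrite !fmapM. Qed.

Definition is_natural (C D : category) (F G : functor C D)
    (eta : forall X, hom (F X) (G X)) : Prop :=
  forall X Y (f : hom X Y), eta Y ∘ fmap F f = fmap G f ∘ eta X.

Definition nat_isomorphic (C D : category) (F G : functor C D) : Prop :=
  exists eta : forall X, hom (F X) (G X),
    is_natural eta /\ forall X, is_iso (eta X).

Definition is_equivalence (C D : category) (F : functor C D) : Prop :=
  exists G : functor D C,
    nat_isomorphic (comp_functor G F) (id_functor C) /\
    nat_isomorphic (comp_functor F G) (id_functor D).

Definition is_left_adjoint_of (C D : category)
    (F : functor C D) (G : functor D C) : Prop :=
  exists (eta : forall X, hom X (G (F X))) (eps : forall Y, hom (F (G Y)) Y),
    [/\ @is_natural _ _ (id_functor C) (comp_functor G F) eta,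
        @is_natural _ _ (comp_functor F G) (id_functor D) eps,
        (forall X, eps (F X) ∘ fmap F (eta X) = idm (F X)) &
        (forall Y, fmap G (eps Y) ∘ eta (G Y) = idm (G Y))].

Definition has_right_adjoint (C D : category) (F : functor C D) : Prop :=
  exists G : functor D C, is_left_adjoint_of F G.

Definition is_small (J : category) : Prop :=
  exists (S : small) (e : S -> J), forall j, exists s, e s = j.

Definition is_cone (J C : category) (D : functor J C) (L : C)
    (p : forall j, hom L (D j)) : Prop :=
  forall i j (a : hom i j), fmap D a ∘ p i = p j.

Definition is_limit (J C : category) (D : functor J C) (L : C)
    (p : forall j, hom L (D j)) : Prop :=
  is_cone p /\
  forall (T : C) (t : forall j, hom T (D j)), is_cone t ->
    exists! h : hom T L, forall j, p j ∘ h = t j.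

Definition is_cocone (J C : category) (D : functor J C) (L : C)
    (p : forall j, hom (D j) L) : Prop :=
  forall i j (a : hom i j), p j ∘ fmap D a = p i.

Definition is_colimit (J C : category) (D : functor J C) (L : C)
    (p : forall j, hom (D j) L) : Prop :=
  is_cocone p /\
  forall (T : C) (t : forall j, hom (D j) T), is_cocone t ->
    exists! h : hom L T, forall j, h ∘ p j = t j.

Definition bicomplete (C : category) : Prop :=
  forall (J : category) (D : functor J C), is_small J ->
    (exists (L : C) (p : forall j, hom L (D j)), is_limit p) /\
    (exists (L : C) (p : forall j, hom (D j) L), is_colimit p).

(* Subobjects: a subobject of A is an [over A] whose arrow is mono, and two
   of them are equal as subobjects when [over_iso] holds. *)

Record over (C : category) (A : C) := Over { odom : C; omap : hom odom A }.
Arguments Over {C A odom} omap.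
Arguments odom {C A} o.
Arguments omap {C A} o.

Definition over_le (C : category) (A : C) (S T : over A) : Prop :=
  exists h : hom (odom S) (odom T), omap T ∘ h = omap S.

Definition over_iso (C : category) (A : C) (S T : over A) : Prop :=
  exists h : hom (odom S) (odom T), is_iso h /\ omap T ∘ h = omap S.

Definition is_subobject (C : category) (A : C) (S : over A) : Prop :=
  is_mono (omap S).

Definition is_intersection (C : category) (A : C) (I : Type)
    (E : I -> over A) (S : over A) : Prop :=
  is_subobject S /\
  (forall i, over_le S (E i)) /\
  (forall T : over A, (forall i, over_le T (E i)) -> over_le T S).

Definition locally_small (C : category) : Prop :=
  forall A : C, exists (I : small) (S : I -> over A),
    forall T : over A, is_subobject T -> exists i, over_iso T (S i).

Record preadditive (C : category) := Preadditive {
  hadd : forall X Y : C, hom X Y -> hom X Y -> hom X Y;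
  hzero : forall X Y : C, hom X Y;
  hopp : forall X Y : C, hom X Y -> hom X Y;
  haddA : forall X Y (f g h : hom X Y), hadd f (hadd g h) = hadd (hadd f g) h;
  haddC : forall X Y (f g : hom X Y), hadd f g = hadd g f;
  hadd0 : forall X Y (f : hom X Y), hadd (hzero X Y) f = f;
  haddN : forall X Y (f : hom X Y), hadd (hopp f) f = hzero X Y;
  compDl : forall X Y Z (g g' : hom Y Z) (f : hom X Y),
    hadd g g' ∘ f = hadd (g ∘ f) (g' ∘ f);
  compDr : forall X Y Z (g : hom Y Z) (f f' : hom X Y),
    g ∘ hadd f f' = hadd (g ∘ f) (g ∘ f') }.

Section Abelian.
Context (C : category) (P : preadditive C).

Definition is_zero_object (Z : C) : Prop :=
  (forall X, exists! f : hom Z X, True) /\ (forall X, exists! f : hom X Z, True).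

Definition has_biproduct (X Y : C) : Prop :=
  exists (B : C) (p1 : hom B X) (p2 : hom B Y) (i1 : hom X B) (i2 : hom Y B),
    [/\ p1 ∘ i1 = idm X, p2 ∘ i2 = idm Y
      & hadd P (i1 ∘ p1) (i2 ∘ p2) = idm B].

Definition is_kernel (X Y K : C) (f : hom X Y) (k : hom K X) : Prop :=
  is_equalizer f (hzero P X Y) k.

Definition is_cokernel (X Y Q : C) (f : hom X Y) (q : hom Y Q) : Prop :=
  is_coequalizer f (hzero P X Y) q.

Record is_abelian : Prop := IsAbelian {
  abelian_zero : exists Z : C, is_zero_object Z;
  abelian_biproduct : forall X Y, has_biproduct X Y;
  abelian_ker : forall X Y (f : hom X Y), exists K (k : hom K X), is_kernel f k;
  abelian_coker : forall X Y (f : hom X Y),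
    exists Q (q : hom Y Q), is_cokernel f q;
  abelian_mono : forall X Y (f : hom X Y), is_mono f ->
    exists Z (g : hom Y Z), is_kernel g f;
  abelian_epi : forall X Y (f : hom X Y), is_epi f ->
    exists Z (g : hom Z X), is_cokernel g f }.

Definition is_additive (F : functor C C) : Prop :=
  forall X Y (f g : hom X Y),
    fmap F (hadd P f g) = hadd P (fmap F f) (fmap F g).

Definition is_right_exact (F : functor C C) : Prop :=
  is_additive F /\
  forall X Y Q (f : hom X Y) (q : hom Y Q),
    is_cokernel f q -> is_cokernel (fmap F f) (fmap F q).

End Abelian.

Reserved Notation "X ⊗ Y" (at level 38, left associativity).
Reserved Notation "f ⊠ g" (at level 38, left associativity).

Record symmonoidal (C : category) := SymMonoidal {
  sm_ob : C -> C -> C where "X ⊗ Y" := (sm_ob X Y);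
  sm_hom : forall X X' Y Y' : C,
    hom X X' -> hom Y Y' -> hom (X ⊗ Y) (X' ⊗ Y')
    where "f ⊠ g" := (sm_hom f g);
  sm_one : C;
  sm_assoc : forall X Y Z, hom ((X ⊗ Y) ⊗ Z) (X ⊗ (Y ⊗ Z));
  sm_assocV : forall X Y Z, hom (X ⊗ (Y ⊗ Z)) ((X ⊗ Y) ⊗ Z);
  sm_lun : forall X, hom (sm_one ⊗ X) X;
  sm_lunV : forall X, hom X (sm_one ⊗ X);
  sm_run : forall X, hom (X ⊗ sm_one) X;
  sm_runV : forall X, hom X (X ⊗ sm_one);
  sm_sym : forall X Y, hom (X ⊗ Y) (Y ⊗ X);
  sm_tens1 : forall X Y, idm X ⊠ idm Y = idm (X ⊗ Y);
  sm_tensM : forall X X' X'' Y Y' Y'' (f' : hom X' X'') (f : hom X X')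
      (g' : hom Y' Y'') (g : hom Y Y'),
    (f' ∘ f) ⊠ (g' ∘ g) = (f' ⊠ g') ∘ (f ⊠ g);
  sm_assocK : forall X Y Z, sm_assocV X Y Z ∘ sm_assoc X Y Z = idm _;
  sm_assocVK : forall X Y Z, sm_assoc X Y Z ∘ sm_assocV X Y Z = idm _;
  sm_lunK : forall X, sm_lunV X ∘ sm_lun X = idm _;
  sm_lunVK : forall X, sm_lun X ∘ sm_lunV X = idm _;
  sm_runK : forall X, sm_runV X ∘ sm_run X = idm _;
  sm_runVK : forall X, sm_run X ∘ sm_runV X = idm _;
  sm_assoc_nat : forall X X' Y Y' Z Z'
      (f : hom X X') (g : hom Y Y') (h : hom Z Z'),
    sm_assoc X' Y' Z' ∘ ((f ⊠ g) ⊠ h) = (f ⊠ (g ⊠ h)) ∘ sm_assoc X Y Z;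
  sm_lun_nat : forall X Y (f : hom X Y),
    sm_lun Y ∘ (idm sm_one ⊠ f) = f ∘ sm_lun X;
  sm_run_nat : forall X Y (f : hom X Y),
    sm_run Y ∘ (f ⊠ idm sm_one) = f ∘ sm_run X;
  sm_sym_nat : forall X X' Y Y' (f : hom X X') (g : hom Y Y'),
    sm_sym X' Y' ∘ (f ⊠ g) = (g ⊠ f) ∘ sm_sym X Y;
  sm_pentagon : forall X Y Z W,
    (idm X ⊠ sm_assoc Y Z W) ∘ sm_assoc X (Y ⊗ Z) W ∘ (sm_assoc X Y Z ⊠ idm W)
    = sm_assoc X Y (Z ⊗ W) ∘ sm_assoc (X ⊗ Y) Z W;
  sm_triangle : forall X Y,
    (idm X ⊠ sm_lun Y) ∘ sm_assoc X sm_one Y = sm_run X ⊠ idm Y;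
  sm_symK : forall X Y, sm_sym Y X ∘ sm_sym X Y = idm _;
  sm_hexagon : forall X Y Z,
    (idm Y ⊠ sm_sym X Z) ∘ sm_assoc Y X Z ∘ (sm_sym X Y ⊠ idm Z)
    = sm_assoc Y Z X ∘ sm_sym X (Y ⊗ Z) ∘ sm_assoc X Y Z;
  sm_sym_unit : forall X, sm_lun X ∘ sm_sym X sm_one = sm_run X }.

Record smcat := SMCat {
  sm_base :> category;
  sm_preadd : preadditive sm_base;
  sm_str : symmonoidal sm_base }.

Definition tens (M : smcat) (X Y : M) : M := sm_ob (sm_str M) X Y.
Definition tensm (M : smcat) (X X' Y Y' : M) (f : hom X X') (g : hom Y Y') :
  hom (tens X Y) (tens X' Y') := sm_hom (sm_str M) f g.
Notation "X ⊗ Y" := (tens X Y) : cat_scope.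
Notation "f ⊠ g" := (tensm f g) : cat_scope.

Definition II {M : smcat} : M := sm_one (sm_str M).

Section Constraints.
Context {M : smcat}.
Implicit Types X Y Z : M.

Definition assoc X Y Z : hom ((X ⊗ Y) ⊗ Z) (X ⊗ (Y ⊗ Z)) :=
  sm_assoc (sm_str M) X Y Z.
Definition assocV X Y Z : hom (X ⊗ (Y ⊗ Z)) ((X ⊗ Y) ⊗ Z) :=
  sm_assocV (sm_str M) X Y Z.
Definition lun X : hom (II ⊗ X) X := sm_lun (sm_str M) X.
Definition lunV X : hom X (II ⊗ X) := sm_lunV (sm_str M) X.
Definition run X : hom (X ⊗ II) X := sm_run (sm_str M) X.
Definition runV X : hom X (X ⊗ II) := sm_runV (sm_str M) X.
Definition sym X Y : hom (X ⊗ Y) (Y ⊗ X) := sm_sym (sm_str M) X Y.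

Lemma tens1 X Y : idm X ⊠ idm Y = idm (X ⊗ Y).
Proof. exact: sm_tens1. Qed.
Lemma tensM X X' X'' Y Y' Y'' (f' : hom X' X'') (f : hom X X')
    (g' : hom Y' Y'') (g : hom Y Y') :
  (f' ∘ f) ⊠ (g' ∘ g) = (f' ⊠ g') ∘ (f ⊠ g).
Proof. exact: sm_tensM. Qed.
Lemma assocK X Y Z : assocV X Y Z ∘ assoc X Y Z = idm _.
Proof. exact: sm_assocK. Qed.
Lemma assocVK X Y Z : assoc X Y Z ∘ assocV X Y Z = idm _.
Proof. exact: sm_assocVK. Qed.
Lemma lunK X : lunV X ∘ lun X = idm _. Proof. exact: sm_lunK. Qed.
Lemma lunVK X : lun X ∘ lunV X = idm _. Proof. exact: sm_lunVK. Qed.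
Lemma runK X : runV X ∘ run X = idm _. Proof. exact: sm_runK. Qed.
Lemma runVK X : run X ∘ runV X = idm _. Proof. exact: sm_runVK. Qed.
Lemma assoc_nat X X' Y Y' Z Z' (f : hom X X') (g : hom Y Y') (h : hom Z Z') :
  assoc X' Y' Z' ∘ ((f ⊠ g) ⊠ h) = (f ⊠ (g ⊠ h)) ∘ assoc X Y Z.
Proof. exact: sm_assoc_nat. Qed.
Lemma lun_nat X Y (f : hom X Y) : lun Y ∘ (idm II ⊠ f) = f ∘ lun X.
Proof. exact: sm_lun_nat. Qed.
Lemma run_nat X Y (f : hom X Y) : run Y ∘ (f ⊠ idm II) = f ∘ run X.
Proof. exact: sm_run_nat. Qed.
Lemma sym_nat X X' Y Y' (f : hom X X') (g : hom Y Y') :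
  sym X' Y' ∘ (f ⊠ g) = (g ⊠ f) ∘ sym X Y.
Proof. exact: sm_sym_nat. Qed.
Lemma pentagon X Y Z W :
  (idm X ⊠ assoc Y Z W) ∘ assoc X (Y ⊗ Z) W ∘ (assoc X Y Z ⊠ idm W)
  = assoc X Y (Z ⊗ W) ∘ assoc (X ⊗ Y) Z W.
Proof. exact: sm_pentagon. Qed.
Lemma triangle X Y : (idm X ⊠ lun Y) ∘ assoc X II Y = run X ⊠ idm Y.
Proof. exact: sm_triangle. Qed.
Lemma symK X Y : sym Y X ∘ sym X Y = idm _.
Proof. exact: sm_symK. Qed.
Lemma hexagon X Y Z :
  (idm Y ⊠ sym X Z) ∘ assoc Y X Z ∘ (sym X Y ⊠ idm Z)
  = assoc Y Z X ∘ sym X (Y ⊗ Z) ∘ assoc X Y Z.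
Proof. exact: sm_hexagon. Qed.
Lemma sym_unit X : lun X ∘ sym X II = run X.
Proof. exact: sm_sym_unit. Qed.

Lemma tens1M X Y Y' Y'' (g' : hom Y' Y'') (g : hom Y Y') :
  idm X ⊠ (g' ∘ g) = (idm X ⊠ g') ∘ (idm X ⊠ g).
Proof. by rewrite -tensM comp1m. Qed.
Lemma tensM1 X Y Y' Y'' (g' : hom Y' Y'') (g : hom Y Y') :
  (g' ∘ g) ⊠ idm X = (g' ⊠ idm X) ∘ (g ⊠ idm X).
Proof. by rewrite -tensM comp1m. Qed.

Lemma can_compl X Y Z (f : hom Y Z) (f' : hom Z Y) (g h : hom X Y) :
  f' ∘ f = idm Y -> f ∘ g = f ∘ h -> g = h.
Proof. by move=> K e; rewrite -[g]comp1m -[h]comp1m -K -!compA e. Qed.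
Lemma can_compr X Y Z (f : hom X Y) (f' : hom Y X) (g h : hom Y Z) :
  f ∘ f' = idm Y -> g ∘ f = h ∘ f -> g = h.
Proof. by move=> K e; rewrite -[g]compm1 -[h]compm1 -K !compA e. Qed.

Lemma tens_unitl_inj X Y (f g : hom X Y) : idm II ⊠ f = idm II ⊠ g -> f = g.
Proof.
move=> e; apply: (can_compr (lunVK X)).
by rewrite -!lun_nat e.
Qed.
Lemma tens_unitr_inj X Y (f g : hom X Y) : f ⊠ idm II = g ⊠ idm II -> f = g.
Proof.
move=> e; apply: (can_compr (runVK X)).
by rewrite -!run_nat e.
Qed.

Lemma lun_tens X Y : lun (X ⊗ Y) ∘ assoc II X Y = lun X ⊠ idm Y.
Proof.
apply: tens_unitl_inj.
have K : assoc II (II ⊗ X) Y ∘ (assoc II II X ⊠ idm Y)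
         ∘ ((assocV II II X ⊠ idm Y) ∘ assocV II (II ⊗ X) Y) = idm _.
  rewrite compA -(compA (assoc II (II ⊗ X) Y)) -tensM1 assocVK tens1.
  by rewrite compm1 assocVK.
apply: (can_compr K).
rewrite tens1M -compA (compA (idm II ⊠ assoc II X Y)) pentagon.
rewrite compA triangle -tens1 -assoc_nat.
by rewrite compA -assoc_nat -compA -tensM1 triangle.
Qed.

Lemma run_tens X Y : (idm X ⊠ run Y) ∘ assoc X Y II = run (X ⊗ Y).
Proof.
apply: tens_unitr_inj.
apply: (can_compl (assocK X Y II)).
rewrite -[in RHS]triangle compA -tens1 assoc_nat -compA -pentagon.
rewrite [RHS]compA [in RHS]compA -tens1M triangle.
by rewrite tensM1 compA assoc_nat.
Qed.

Lemma assocV_nat X X' Y Y' Z Z' (f : hom X X') (g : hom Y Y') (h : hom Z Z') :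
  assocV X' Y' Z' ∘ (f ⊠ (g ⊠ h)) = ((f ⊠ g) ⊠ h) ∘ assocV X Y Z.
Proof.
apply: (can_compl (assocK X' Y' Z')).
by rewrite !compA assocVK comp1m assoc_nat -compA assocVK compm1.
Qed.

End Constraints.

(* swap_last : (x ⊗ y) ⊗ z |-> (x ⊗ z) ⊗ y *)
Section SwapLast.
Context {M : smcat}.
Implicit Types X Y Z W : M.

Fact swap_last_key : unit. Proof. exact: tt. Qed.
Definition swap_last X Y Z : hom ((X ⊗ Y) ⊗ Z) ((X ⊗ Z) ⊗ Y) :=
  locked_with swap_last_key
    (assocV X Z Y ∘ (idm X ⊠ sym Y Z) ∘ assoc X Y Z).

Lemma swap_lastE X Y Z :
  swap_last X Y Z = assocV X Z Y ∘ (idm X ⊠ sym Y Z) ∘ assoc X Y Z.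
Proof. by rewrite /swap_last unlock. Qed.

Lemma assoc_swap_last X Y Z :
  assoc X Z Y ∘ swap_last X Y Z = (idm X ⊠ sym Y Z) ∘ assoc X Y Z.
Proof. by rewrite swap_lastE !compA assocVK comp1m. Qed.

Lemma swap_last_nat X X' Y Y' Z Z'
    (f : hom X X') (g : hom Y Y') (h : hom Z Z') :
  swap_last X' Y' Z' ∘ ((f ⊠ g) ⊠ h) = ((f ⊠ h) ⊠ g) ∘ swap_last X Y Z.
Proof.
rewrite !swap_lastE -[in LHS]compA assoc_nat compA -(compA (assocV _ _ _)) -tensM.
rewrite comp1m sym_nat -[f in f ⊠ _]compm1 tensM compA assocV_nat.
by rewrite !compA.
Qed.

Lemma swap_last_assoc X Y Z W :
  (assoc X Z W ⊠ idm Y) ∘ swap_last (X ⊗ Z) Y W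
  = assocV X (Z ⊗ W) Y ∘ (idm X ⊠ swap_last Z Y W)
    ∘ assoc X (Z ⊗ Y) W ∘ (assoc X Z Y ⊠ idm W).
Proof.
apply: (can_compl (assocK X (Z ⊗ W) Y)).
have K : (idm X ⊠ assocV Z W Y) ∘ (idm X ⊠ assoc Z W Y) = idm _.
  by rewrite -tens1M assocK tens1.
apply: (can_compl K).
rewrite !compA pentagon -[in LHS]compA assoc_swap_last.
rewrite -(compA (idm X ⊠ assoc Z W Y)) assocVK compm1.
rewrite -tens1M assoc_swap_last tens1M.
rewrite -(compA _ (assoc X _ W)) -(compA (idm X ⊠ (idm Z ⊠ sym Y W))).
rewrite (compA (idm X ⊠ assoc Z Y W)) pentagon.
by rewrite compA -tens1 assoc_nat -compA.
Qed.

Lemma swap_last_tens X Y Z W :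
  (assoc X Z W ⊠ idm Y) ∘ swap_last (X ⊗ Z) Y W ∘ (swap_last X Y Z ⊠ idm W)
  = swap_last X Y (Z ⊗ W) ∘ assoc (X ⊗ Y) Z W.
Proof.
rewrite swap_last_assoc -compA -tensM1 assoc_swap_last tensM1.
rewrite compA -(compA _ (assoc X (Z ⊗ Y) W)) assoc_nat.
have -> : swap_last X Y (Z ⊗ W) ∘ assoc (X ⊗ Y) Z W =
  assocV X (Z ⊗ W) Y ∘ ((idm X ⊠ (sym Y (Z ⊗ W) ∘ assoc Y Z W))
  ∘ (assoc X (Y ⊗ Z) W ∘ (assoc X Y Z ⊠ idm W))).
  rewrite swap_lastE -!compA; congr (_ ∘ _); rewrite tens1M -!compA.
  by congr (_ ∘ _); rewrite compA pentagon.
rewrite -!compA; congr (_ ∘ _); rewrite !compA -tens1M.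
congr ((idm X ⊠ _) ∘ _ ∘ _).
by rewrite swap_lastE -!compA [(_ ⊠ _) ∘ _]compA hexagon !compA assocK comp1m.
Qed.

End SwapLast.

Program Definition tensL (M : smcat) (X : M) : functor M M :=
  @Functor M M (fun Y => X ⊗ Y) (fun Y Y' f => idm X ⊠ f) _ _.
Next Obligation. by move=> * /=; rewrite tens1. Qed.
Next Obligation. by move=> * /=; rewrite tens1M. Qed.

Program Definition tensR (M : smcat) (X : M) : functor M M :=
  @Functor M M (fun Y => Y ⊗ X) (fun Y Y' f => f ⊠ idm X) _ _.
Next Obligation. by move=> * /=; rewrite tens1. Qed.
Next Obligation. by move=> * /=; rewrite tensM1. Qed.

Definition tensor_right_exact (M : smcat) : Prop :=
  forall X : M, is_right_exact (sm_preadd M) (tensL X) /\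
                is_right_exact (sm_preadd M) (tensR X).

Definition hplus (M : smcat) (X Y : M) (f g : hom X Y) : hom X Y :=
  hadd (sm_preadd M) f g.
Definition h0 {M : smcat} {X Y : M} : hom X Y := hzero (sm_preadd M) X Y.

Record monoid (M : smcat) := Monoid {
  mcar :> ob M;
  mm : hom (mcar ⊗ mcar) mcar;
  mu : hom II mcar;
  mmA : mm ∘ (mm ⊠ idm mcar) = mm ∘ (idm mcar ⊠ mm) ∘ assoc _ _ _;
  mm1l : mm ∘ (mu ⊠ idm mcar) = lun mcar;
  mm1r : mm ∘ (idm mcar ⊠ mu) = run mcar }.
Arguments mm {M m} : rename.
Arguments mu {M m} : rename.

Definition has_left_internal_hom (M : smcat) (A : monoid M) : Prop :=
  has_right_adjoint (tensL (A : M)).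

(* Left modules over A^e = A ⊗ A^o are presented as A-bimodules. *)
Record bimodule (M : smcat) (A : monoid M) := Bimodule {
  bcar :> ob M;
  lact : hom (A ⊗ bcar) bcar;
  ract : hom (bcar ⊗ A) bcar;
  lact1 : lact ∘ (mu ⊠ idm bcar) = lun bcar;
  lactA : lact ∘ (mm ⊠ idm bcar) = lact ∘ (idm (A : M) ⊠ lact) ∘ assoc _ _ _;
  ract1 : ract ∘ (idm bcar ⊠ mu) = run bcar;
  ractA : ract ∘ (ract ⊠ idm (A : M)) = ract ∘ (idm bcar ⊠ mm) ∘ assoc _ _ _;
  lractA : ract ∘ (lact ⊠ idm (A : M))
           = lact ∘ (idm (A : M) ⊠ ract) ∘ assoc _ _ _ }.
Arguments lact {M A} b : rename.
Arguments ract {M A} b : rename.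

Definition is_bimod_map (M : smcat) (A : monoid M) (X Y : bimodule A)
    (f : hom (X : M) Y) : Prop :=
  f ∘ lact X = lact Y ∘ (idm (A : M) ⊠ f) /\
  f ∘ ract X = ract Y ∘ (f ⊠ idm (A : M)).

Section Bimod.
Context {M : smcat} (A : monoid M).

Definition bimod_hom (X Y : bimodule A) : small :=
  {f : hom (X : M) Y | is_bimod_map f}.

Lemma bimod_homP (X Y : bimodule A) (f g : bimod_hom X Y) :
  sval f = sval g -> f = g.
Proof.
case: f g => [f Hf] [g Hg] /= e; case: g / e Hg => Hg.
by rewrite (proof_irrelevance _ Hf Hg).
Qed.

Lemma bimod_id_map (X : bimodule A) : is_bimod_map (idm (X : M)).
Proof. by split; rewrite tens1 comp1m compm1. Qed.

Lemma bimod_comp_map (X Y Z : bimodule A) (g : bimod_hom Y Z)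
  (f : bimod_hom X Y) : is_bimod_map (sval g ∘ sval f).
Proof.
case: f g => [f [fl fr]] [g [gl gr]] /=; split.
  by rewrite -compA fl compA gl -compA -tens1M.
by rewrite -compA fr compA gr -compA -tensM1.
Qed.

Program Definition Bimod : category :=
  @Category (bimodule A) bimod_hom (fun X => exist _ _ (bimod_id_map X))
    (fun X Y Z g f => exist _ _ (bimod_comp_map g f)) _ _ _.
Next Obligation. by move=> *; apply: bimod_homP; rewrite /= comp1m. Qed.
Next Obligation. by move=> *; apply: bimod_homP; rewrite /= compm1. Qed.
Next Obligation. by move=> *; apply: bimod_homP; rewrite /= compA. Qed.

Definition regular_bimod : bimodule A.
Proof. exact: (@Bimodule M A A mm mm (mm1l A) (mmA A) (mm1r A) (mmA A) (mmA A)). Defined.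

(* A ⊗ X as a left A^e-module: a.(b ⊗ x).c = abc ⊗ x *)
Definition free_bimod (X : M) : bimodule A.
Proof.
refine (@Bimodule M A (A ⊗ X) ((mm ⊠ idm X) ∘ assocV A A X)
          ((mm ⊠ idm X) ∘ swap_last A X A) _ _ _ _ _).
- rewrite -compA -tens1 assocV_nat compA -tensM1 mm1l -lun_tens.
  by rewrite -compA assocVK compm1.
- rewrite -[in LHS]compA -tens1 assocV_nat compA -tensM1 mmA !tensM1.
  rewrite tens1M !compA -(compA _ (assocV A A X)) assocV_nat !compA.
  rewrite -!compA; congr (_ ∘ (_ ∘ _)).
  apply: (can_compr (assocVK (A ⊗ A) A X)).
  rewrite -!compA assocK compm1.
  apply: (can_compl (assocK A (A ⊗ A) X)).
  have K : (idm (A : M) ⊠ assocV A A X) ∘ (idm (A : M) ⊠ assoc A A X) = idm _.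
    by rewrite -tens1M assocK tens1.
  apply: (can_compl K).
  rewrite !compA pentagon -(compA (idm (A : M) ⊠ assoc A A X)) assocVK compm1.
  by rewrite -tens1M assocVK tens1 comp1m.
- rewrite -compA -tens1 swap_last_nat compA -tensM1 mm1r swap_lastE.
  rewrite !compA -triangle -(compA _ (assoc A II X)) assocVK compm1.
  by rewrite -tens1M sym_unit run_tens.
- rewrite tensM1 -[LHS]compA (compA (swap_last A X A)) swap_last_nat.
  rewrite !compA -tensM1 mmA !tensM1.
  rewrite -(compA _ (assoc A A A ⊠ idm X)) -(compA _ (_ ∘ _)).
  rewrite swap_last_tens -[in RHS](compA _ (swap_last A X A)).
  by rewrite -tens1 swap_last_nat !compA.
- rewrite tensM1 -[LHS]compA (compA (swap_last A X A)) swap_last_nat.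
  rewrite !compA -tensM1 mmA !tensM1.
  rewrite -(compA _ (assoc A A A ⊠ idm X)) swap_last_assoc.
  rewrite tens1M !compA -[in RHS](compA _ (assocV A A X)) assocV_nat.
  rewrite -!compA; congr (_ ∘ (_ ∘ (_ ∘ (_ ∘ _)))).
  by rewrite -tensM1 assocVK tens1 compm1.
Defined.

(* A ⊗ A with a.(b ⊗ b').c = ab ⊗ b'c *)
Definition outer_bimod : bimodule A.
Proof.
refine (@Bimodule M A (A ⊗ A) (lact (free_bimod A))
          ((idm (A : M) ⊠ mm) ∘ assoc A A A)
          (lact1 (free_bimod A)) (lactA (free_bimod A)) _ _ _).
- by rewrite -compA -tens1 assoc_nat compA -tens1M mm1r run_tens.
- rewrite tensM1 -!compA -[in RHS]tens1 (compA (assoc A A A) (_ ⊠ mm)).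
  rewrite [in RHS]assoc_nat !compA -[in RHS]tens1M.
  rewrite -(compA _ (assoc A A A) (_ ⊠ _)) assoc_nat !compA -tens1M mmA.
  rewrite !tens1M -!compA; congr (_ ∘ (_ ∘ _)).
  by rewrite compA pentagon.
- rewrite /= tensM1 -!compA (compA (assoc A A A)) assoc_nat tens1 !compA.
  rewrite -tensM comp1m compm1.
  have -> : mm ⊠ mm = (mm ⊠ idm (A : M)) ∘ (idm ((A : M) ⊗ A) ⊠ mm).
    by rewrite -tensM comp1m compm1.
  rewrite tens1M !compA.
  rewrite -(compA _ (assocV A A A)) assocV_nat tens1 !compA.
  rewrite -!compA; congr (_ ∘ (_ ∘ _)).
  apply: (can_compl (assocK A A (A ⊗ A))); rewrite !compA assocVK comp1m.
  by rewrite -pentagon -!compA -tensM1 assocVK tens1 compm1.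
Defined.

Lemma free_bimod_map (X Y : M) (f : hom X Y) :
  @is_bimod_map M A (free_bimod X) (free_bimod Y) (idm (A : M) ⊠ f).
Proof.
split => /=.
  rewrite compA -tensM comp1m compm1 -!compA assocV_nat tens1 compA -tensM.
  by rewrite comp1m compm1.
rewrite compA -tensM comp1m compm1 -!compA swap_last_nat tens1 compA -tensM.
by rewrite comp1m compm1.
Qed.

Program Definition free_bimod_functor : functor M Bimod :=
  @Functor M Bimod free_bimod (fun X Y f => exist _ _ (free_bimod_map f)) _ _.
Next Obligation. by move=> X; apply: bimod_homP; rewrite /= tens1. Qed.
Next Obligation. by move=> *; apply: bimod_homP; rewrite /= tens1M. Qed.

Definition mult_splits : Prop :=
  exists s : hom (A : M) (A ⊗ A),
    @is_bimod_map M A regular_bimod outer_bimod s /\ mm ∘ s = idm (A : M).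

Definition is_azumaya : Prop := is_equivalence free_bimod_functor /\ mult_splits.

Definition bimod_divides (X Y : bimodule A) : Prop :=
  exists (k : nat) (f : 'I_k -> hom (X : M) Y) (g : 'I_k -> hom (Y : M) X),
    [/\ (1 <= k)%N, (forall i, is_bimod_map (f i)), (forall i, is_bimod_map (g i))
      & \big[@hplus M X X/h0]_(i < k) (g i ∘ f i) = idm (X : M)].

End Bimod.

Definition Z {M : smcat} (X : M) : small := hom II X.

Definition Z_map (M : smcat) (X Y : M) (f : hom X Y) : Z X -> Z Y :=
  fun z => f ∘ z.

Definition Z_faithful (M : smcat) : Prop :=
  forall (X Y : M) (f g : hom X Y), Z_map f =1 Z_map g -> f = g.

Section ZA.
Context {M : smcat} (A : monoid M).

Definition zmul (z w : Z (A : M)) : Z (A : M) := mm ∘ (z ⊠ w) ∘ lunV II.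
Definition zscale (s : Z (II : M)) (z : Z (A : M)) : Z (A : M) :=
  lun A ∘ (s ⊠ z) ∘ lunV II.

Definition is_Zalg_aut (theta : Z (A : M) -> Z (A : M)) : Prop :=
  [/\ bijective theta,
      (forall z w, theta (hplus z w) = hplus (theta z) (theta w)),
      (forall s z, theta (zscale s z) = zscale s (theta z)),
      (forall z w, theta (zmul z w) = zmul (theta z) (theta w))
    & theta mu = mu].

Definition is_monoid_aut (gamma : hom (A : M) A) : Prop :=
  [/\ is_iso gamma, gamma ∘ mm = mm ∘ (gamma ⊠ gamma) & gamma ∘ mu = mu].

(* z ▷ f and f ◁ z *)
Definition ltri (X : M) (z : Z (A : M)) (f : hom X A) : hom X A :=
  mm ∘ (z ⊠ f) ∘ lunV X.
Definition rtri (X : M) (f : hom X A) (z : Z (A : M)) : hom X A :=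
  mm ∘ (f ⊠ z) ∘ runV X.

Definition is_twisted_map (sigma tau : Z (A : M) -> Z (A : M))
    (f : hom (A : M) A) : Prop :=
  f ∘ mm = mm ∘ (idm (A : M) ⊠ f) /\
  forall z, f ∘ rtri (idm (A : M)) (sigma z) = rtri f (tau z).

Definition twisted_divides (sigma tau : Z (A : M) -> Z (A : M)) : Prop :=
  exists (k : nat) (f g : 'I_k -> hom (A : M) A),
    [/\ (1 <= k)%N, (forall i, is_twisted_map sigma tau (f i)),
        (forall i, is_twisted_map tau sigma (g i))
      & \big[@hplus M A A/h0]_(i < k) (g i ∘ f i) = idm (A : M)].

Definition in_H (theta : Z (A : M) -> Z (A : M)) : Prop :=
  [/\ is_Zalg_aut theta, twisted_divides theta id & twisted_divides id theta].

(* The objects J; they are determined by their universal property up to a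
   unique isomorphism over A, and so are the tensor products over them, hence
   the choices in [J_mult_iso] are immaterial. *)

Definition is_J (sigma delta : Z (A : M) -> Z (A : M)) (J : over (A : M)) :
    Prop :=
  exists E : Z (A : M) -> over (A : M),
    (forall t, is_equalizer (ltri (sigma t) (idm (A : M)))
                            (rtri (idm (A : M)) (delta t)) (omap (E t))) /\
    is_intersection E J.

Definition is_J_mult (J1 J2 J3 : over (A : M))
    (m : hom (odom J1 ⊗ odom J2) (odom J3)) : Prop :=
  omap J3 ∘ m = mm ∘ (omap J1 ⊠ omap J2).

(* The map induced by m^delta_{sigma,gamma} on the tensor product over
   _delta J_delta, i.e. on the coequalizer of the two actions, is invertible *)
Definition J_mult_iso (sigma delta gamma : Z (A : M) -> Z (A : M)) : Prop :=
  exists (Jsd Jdg Jdd Jsg : over (A : M))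
         (m : hom (odom Jsd ⊗ odom Jdg) (odom Jsg))
         (ra : hom (odom Jsd ⊗ odom Jdd) (odom Jsd))
         (la : hom (odom Jdd ⊗ odom Jdg) (odom Jdg))
         (Q : M) (q : hom (odom Jsd ⊗ odom Jdg) Q) (mbar : hom Q (odom Jsg)),
    [/\ is_J sigma delta Jsd, is_J delta gamma Jdg, is_J delta delta Jdd
      & is_J sigma gamma Jsg] /\
    [/\ is_J_mult m, is_J_mult ra & is_J_mult la] /\
    [/\ is_coequalizer (ra ⊠ idm (odom Jdg))
                       ((idm (odom Jsd) ⊠ la) ∘ assoc _ _ _) q,
        mbar ∘ q = m & is_iso mbar].

(* The target of the first map is _theta J_theta = _1 J_1 *)
Definition in_G (theta : Z (A : M) -> Z (A : M)) : Prop :=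
  [/\ is_Zalg_aut theta, J_mult_iso theta id theta & J_mult_iso id theta id].

Record inverse_data (X : over (A : M)) := InverseData {
  inv_sub : over (A : M);
  inv_subP : is_subobject inv_sub;
  inv_m : hom (odom X ⊗ odom inv_sub) II;
  inv_mV : hom II (odom X ⊗ odom inv_sub);
  inv_n : hom (odom inv_sub ⊗ odom X) II;
  inv_mK : inv_mV ∘ inv_m = idm _;
  inv_mVK : inv_m ∘ inv_mV = idm _;
  inv_n_iso : is_iso inv_n;
  inv_mE : mu ∘ inv_m = mm ∘ (omap X ⊠ omap inv_sub);
  inv_nE : mu ∘ inv_n = mm ∘ (omap inv_sub ⊠ omap X) }.

Definition is_invertible_subobject (X : over (A : M)) : Prop :=
  is_subobject X /\ inhabited (inverse_data X).

Definition inv_mult (X X' : over (A : M)) : over (A : M) :=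
  Over (mm ∘ (omap X ⊠ omap X')).

Definition Phi_of (X : over (A : M)) (W : inverse_data X) :
    Z (A : M) -> Z (A : M) :=
  fun t => mm ∘ (omap X ⊠ ltri t (omap (inv_sub W))) ∘ inv_mV W.

Definition Gamma_of (X : over (A : M)) (W : inverse_data X) :
    hom (A : M) A :=
  let iX := omap X in let iY := omap (inv_sub W) in
  mm ∘ (idm (A : M) ⊠ mm) ∘ assoc A A A
  ∘ ((iX ⊠ idm (A : M)) ⊠ iY)
  ∘ (sym A (odom X) ⊠ idm (odom (inv_sub W)))
  ∘ assocV A (odom X) (odom (inv_sub W))
  ∘ (idm (A : M) ⊠ inv_mV W)
  ∘ runV A.

(* When mu is mono, inverse data are unique up to isomorphism, so that for an
   invertible subobject [Phi] and [Gamma] do not depend on the choice made by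
   [epsilon]; outside of invertible subobjects they are junk. *)
Definition Phi (X : over (A : M)) : Z (A : M) -> Z (A : M) :=
  epsilon (inhabits id) (fun p => exists W : inverse_data X, p = Phi_of W).

Definition Gamma (X : over (A : M)) : hom (A : M) A :=
  epsilon (inhabits (idm (A : M)))
    (fun g => exists W : inverse_data X, g = Gamma_of W).

End ZA.

(* Groups presented by a subset [gmem] of a type, modulo an equivalence
   relation [geqv]; [is_group] asserts that this is indeed a group. *)
Record pregroup := Pregroup {
  gcar : Type;
  gmem : gcar -> Prop;
  geqv : gcar -> gcar -> Prop;
  gmul : gcar -> gcar -> gcar;
  gone : gcar }.
Arguments gmem : clear implicits.
Arguments geqv : clear implicits.
Arguments gmul : clear implicits.

Record is_group (G : pregroup) : Prop := IsGroup {
  geqv_refl : forall x, gmem G x -> geqv G x x;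
  geqv_sym : forall x y, gmem G x -> gmem G y -> geqv G x y -> geqv G y x;
  geqv_trans : forall x y z, gmem G x -> gmem G y -> gmem G z ->
    geqv G x y -> geqv G y z -> geqv G x z;
  gmulP : forall x y, gmem G x -> gmem G y -> gmem G (gmul G x y);
  gmul_eqv : forall x x' y y', gmem G x -> gmem G x' -> gmem G y -> gmem G y' ->
    geqv G x x' -> geqv G y y' -> geqv G (gmul G x y) (gmul G x' y');
  gmul_assoc : forall x y z, gmem G x -> gmem G y -> gmem G z ->
    geqv G (gmul G x (gmul G y z)) (gmul G (gmul G x y) z);
  goneP : gmem G (gone G);
  gmul1l : forall x, gmem G x -> geqv G (gmul G (gone G) x) x;
  gmul1r : forall x, gmem G x -> geqv G (gmul G x (gone G)) x;
  ginv_ex : forall x, gmem G x -> exists y, gmem G y /\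
    geqv G (gmul G x y) (gone G) /\ geqv G (gmul G y x) (gone G) }.

Record is_group_hom (G H : pregroup) (f : gcar G -> gcar H) : Prop :=
  IsGroupHom {
  ghom_dom : is_group G;
  ghom_cod : is_group H;
  ghom_mem : forall x, gmem G x -> gmem H (f x);
  ghom_eqv : forall x y, gmem G x -> gmem G y -> geqv G x y ->
    geqv H (f x) (f y);
  ghom_mul : forall x y, gmem G x -> gmem G y ->
    geqv H (f (gmul G x y)) (gmul H (f x) (f y)) }.

Definition is_ginjective (G H : pregroup) (f : gcar G -> gcar H) : Prop :=
  forall x y, gmem G x -> gmem G y -> geqv H (f x) (f y) -> geqv G x y.

Definition is_gsurjective (G H : pregroup) (f : gcar G -> gcar H) : Prop :=
  forall y, gmem H y -> exists x, gmem G x /\ geqv H (f x) y.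

Definition is_group_iso (G H : pregroup) (f : gcar G -> gcar H) : Prop :=
  [/\ is_group_hom f, is_ginjective f & is_gsurjective f].

Section Groups.
Context {M : smcat} (A : monoid M).

Definition Inv : pregroup :=
  Pregroup (@is_invertible_subobject M A) (@over_iso M A)
           (@inv_mult M A) (Over mu).

Definition Aut_alg : pregroup :=
  Pregroup (@is_monoid_aut M A) eq (fun g f => g ∘ f) (idm (A : M)).

Definition Aut_Zalg : pregroup :=
  Pregroup (@is_Zalg_aut M A) (@eqfun _ _) (fun s t => s \o t) id.

Definition Ggroup : pregroup :=
  Pregroup (@in_G M A) (@eqfun _ _) (fun s t => s \o t) id.

(* Subgroups of Aut_Zalg share its carrier type, so the maps below only differ
   in the codomain they are asserted to have. *)
Definition omega : gcar Aut_alg -> gcar Ggroup := fun gamma => Z_map gamma.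
Definition Omega : gcar Aut_alg -> gcar Aut_Zalg := fun gamma => Z_map gamma.
Definition Phi_hat : gcar Inv -> gcar Ggroup := fun X => Phi X.
Definition varsigma : gcar Ggroup -> gcar Aut_Zalg := fun theta => theta.

End Groups.

(* Main.v *)
(* Since [A] has an internal hom and [Z] is faithful, a map out of [A ⊗ Y] is
   determined by its values on elementary tensors of elements [II -> A] and
   [II -> Y], so identities can be checked in the ring [Z A].  Full faithfulness
   of [A ⊗ -] turns a Casimir element [e' ⊗ e''] of [A ⊗ A] into a functional
   [b |-> e' b e''] with values in [II].  Applied to [A ⊗ A | A], which reads
   [Σ z_i e_i = 1 ⊗ 1], this gives a dual basis [id_A = Σ z_i ρ_i]; applied to a
   section of [m], it gives a retraction of the unit.

   For an automorphism γ, the elements [x] with [γ(a) x = x a] form a retract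
   [X] of [A], the image of the idempotent [b |-> γ(p') b p''] attached to a
   separability element [p].  With [Y] the one with [a y = y γ(a)], the elements
   [b_i = γ(e_i') e_i''] of [X] and [c_i = p' z_i γ(p'')] of [Y] satisfy
   [Σ b_i c_i = 1]; this makes [X] invertible with inverse [Y], and also proves
   [A_γ | A_1].  Conversely an invertible [X] is a retract of [A], so that
   [Γ_X(a) = Σ x_i a y_i] is the only map with [Γ_X(a) x = x a], and [X] is the
   object attached to [Γ_X].  Finally both [θ ∈ G] and [θ ∈ H] provide a sum
   [Σ b_i c_i = 1], and then [a |-> Σ b_i a c_i] is an automorphism inducing θ. *)

From mathcomp Require Import all_boot.
From HB Require Import structures.
From Stdlib Require Import ClassicalEpsilon FunctionalExtensionality.
Require Import Defs.
Set Implicit Arguments.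
Unset Strict Implicit.
Unset Printing Implicit Defensive.
Local Open Scope cat_scope.

(** * Additivity and elements *)

Section Additive.
Context {M : smcat}.
Implicit Types X Y W : M.

Lemma hplusA X Y : associative (@hplus M X Y).
Proof. by move=> f g h; apply: haddA. Qed.
Lemma hplusC X Y : commutative (@hplus M X Y).
Proof. by move=> f g; apply: haddC. Qed.
Lemma hplus0 X Y : left_id (@h0 M X Y) (@hplus M X Y).
Proof. by move=> f; apply: hadd0. Qed.

HB.instance Definition _ X Y :=
  Monoid.isComLaw.Build (hom X Y) h0 (@hplus M X Y)
    (@hplusA X Y) (@hplusC X Y) (@hplus0 X Y).

Definition hneg X Y (f : hom X Y) : hom X Y := hopp (sm_preadd M) f.
Definition hminus X Y (f g : hom X Y) : hom X Y := hplus f (hneg g).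

Lemma hplusN X Y (f : hom X Y) : hplus (hneg f) f = h0.
Proof. exact: haddN. Qed.

(** Lets preservation of zero be deduced from preservation of sums, for composition and for the
    tensor product alike. *)
Lemma hplus_idem0 X Y (f : hom X Y) : hplus f f = f -> f = h0.
Proof. by move=> e; rewrite -[LHS]hplus0 -{1}(hplusN f) -hplusA e hplusN. Qed.

Lemma hminus_eq0 X Y (f g : hom X Y) : hminus f g = h0 <-> f = g.
Proof.
rewrite /hminus; split=> [e | ->]; last by rewrite hplusC hplusN.
by rewrite -[g]hplus0 -e -hplusA hplusN hplusC hplus0.
Qed.

Lemma compDlE X Y W (g g' : hom Y W) (f : hom X Y) :
  hplus g g' ∘ f = hplus (g ∘ f) (g' ∘ f).
Proof. exact: compDl. Qed.
Lemma compDrE X Y W (g : hom Y W) (f f' : hom X Y) :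
  g ∘ hplus f f' = hplus (g ∘ f) (g ∘ f').
Proof. exact: compDr. Qed.
Lemma comp0m X Y W (f : hom X Y) : @h0 M Y W ∘ f = h0.
Proof. by apply: hplus_idem0; rewrite -compDlE hplus0. Qed.
Lemma compm0 X Y W (f : hom Y W) : f ∘ @h0 M X Y = h0.
Proof. by apply: hplus_idem0; rewrite -compDrE hplus0. Qed.

Lemma compBl X Y W (g g' : hom Y W) (f : hom X Y) :
  hminus g g' ∘ f = hminus (g ∘ f) (g' ∘ f).
Proof.
rewrite /hminus compDlE; congr (hplus _ _).
have e : hplus (hneg g' ∘ f) (g' ∘ f) = h0 by rewrite -compDlE hplusN comp0m.
rewrite -[LHS]hplus0 hplusC -(hplusN (g' ∘ f)) (hplusC (hneg _)) hplusA e.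
by rewrite hplus0.
Qed.

Lemma comp_suml X Y W k (g : 'I_k -> hom Y W) (f : hom X Y) :
  (\big[@hplus M Y W/h0]_(i < k) g i) ∘ f
  = \big[@hplus M X W/h0]_(i < k) (g i ∘ f).
Proof.
by apply: (big_morph (fun g => g ∘ f)) => [g1 g2|]; [apply: compDlE | apply: comp0m].
Qed.
Lemma comp_sumr X Y W k (g : hom Y W) (f : 'I_k -> hom X Y) :
  g ∘ (\big[@hplus M X Y/h0]_(i < k) f i)
  = \big[@hplus M X W/h0]_(i < k) (g ∘ f i).
Proof. by apply: big_morph => [g1 g2|]; [apply: compDrE | apply: compm0]. Qed.

End Additive.

(** * Elementary tensors of elements and the action of the constraints on them *)

Section Elements.
Context {M : smcat}.
Implicit Types X Y W : M.

Lemma run_tens_unit X : run (X ⊗ II) = run X ⊠ idm (II : M).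
Proof. by apply: (can_compl (runK X)); rewrite run_nat. Qed.

Lemma lun_unit : lun (II : M) = run II.
Proof.
apply: tens_unitl_inj; apply: (can_compr (assocVK II II II)).
by rewrite triangle -run_tens_unit run_tens.
Qed.

Lemma lunV_unit : lunV (II : M) = runV II.
Proof. by apply: (can_compl (lunK II)); rewrite lunVK lun_unit runVK. Qed.

Lemma lunV_nat X Y (f : hom X Y) : lunV Y ∘ f = (idm II ⊠ f) ∘ lunV X.
Proof.
by apply: (can_compl (lunK Y)); rewrite !compA lunVK comp1m lun_nat -compA lunVK compm1.
Qed.
Lemma runV_nat X Y (f : hom X Y) : runV Y ∘ f = (f ⊠ idm II) ∘ runV X.
Proof.
by apply: (can_compl (runK Y)); rewrite !compA runVK comp1m run_nat -compA runVK compm1.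
Qed.

(** The elementary tensor of two elements. A general element of [X ⊗ Y] need not have this form;
    [separating] and [fin_projective_pt] bridge the gap. *)
Definition pt X Y (x : Z X) (y : Z Y) : Z (X ⊗ Y) := (x ⊠ y) ∘ lunV II.

Lemma tens_pt X Y X' Y' (f : hom X X') (g : hom Y Y') (x : Z X) (y : Z Y) :
  (f ⊠ g) ∘ pt x y = pt (f ∘ x) (g ∘ y).
Proof. by rewrite /pt compA -tensM. Qed.

Lemma lunV_pt X (x : Z X) : lunV X ∘ x = pt (idm II) x.
Proof. exact: lunV_nat. Qed.
Lemma runV_pt X (x : Z X) : runV X ∘ x = pt x (idm II).
Proof. by rewrite /pt lunV_unit runV_nat. Qed.

(** Scalars act on elements by precomposition; this and [pt_scall] let them move freely between the
    two tensor factors. *)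
Lemma pt_scalr X Y (x : Z X) (y : Z Y) (s : Z (II : M)) :
  pt x (y ∘ s) = pt x y ∘ s.
Proof. by rewrite /pt -compA lunV_nat compA -tensM compm1. Qed.
Lemma pt_scall X Y (x : Z X) (y : Z Y) (s : Z (II : M)) :
  pt (x ∘ s) y = pt x y ∘ s.
Proof. by rewrite /pt lunV_unit -compA runV_nat compA -tensM compm1. Qed.

Lemma lun_pt X (s : Z (II : M)) (x : Z X) : lun X ∘ pt s x = x ∘ s.
Proof.
by rewrite -[s in LHS]comp1m pt_scall -lunV_pt !compA lunVK comp1m.
Qed.
Lemma run_pt X (s : Z (II : M)) (x : Z X) : run X ∘ pt x s = x ∘ s.
Proof.
by rewrite -[s in LHS]comp1m pt_scalr -runV_pt !compA runVK comp1m.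
Qed.

Lemma sym_pt X Y (x : Z X) (y : Z Y) : sym X Y ∘ pt x y = pt y x.
Proof.
rewrite /pt compA sym_nat -compA; congr (_ ∘ _).
by apply: (can_compl (lunK II)); rewrite compA sym_unit -lun_unit.
Qed.

(** By naturality only the case of three copies of the unit remains, and there [e] is a form of the
    triangle axiom. *)
Lemma assoc_pt X Y W (x : Z X) (y : Z Y) (w : Z W) :
  assoc X Y W ∘ pt (pt x y) w = pt x (pt y w).
Proof.
have e : assoc II II II ∘ (lunV II ⊠ idm II) = idm II ⊠ lunV (II : M).
  have K : (idm II ⊠ lunV (II : M)) ∘ (idm II ⊠ lun (II : M)) = idm _.
    by rewrite -tens1M lunK tens1.
  apply: (can_compl K); rewrite compA triangle -tens1M lunVK -tensM1.
  by rewrite -lun_unit lunVK.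
have -> : pt (pt x y) w = ((x ⊠ y) ⊠ w) ∘ (lunV II ⊠ idm II) ∘ lunV II.
  by rewrite /pt -tensM compm1.
have -> : pt x (pt y w) = (x ⊠ (y ⊠ w)) ∘ (idm II ⊠ lunV II) ∘ lunV II.
  by rewrite /pt -tensM compm1.
by rewrite !compA assoc_nat -(compA _ (assoc _ _ _)) e.
Qed.

Lemma assocV_pt X Y W (x : Z X) (y : Z Y) (w : Z W) :
  assocV X Y W ∘ pt x (pt y w) = pt (pt x y) w.
Proof. by rewrite -assoc_pt compA assocK comp1m. Qed.

Lemma swap_last_pt X Y W (x : Z X) (y : Z Y) (w : Z W) :
  swap_last X Y W ∘ pt (pt x y) w = pt (pt x w) y.
Proof.
by rewrite swap_lastE -!compA assoc_pt tens_pt sym_pt comp1m assocV_pt.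
Qed.

End Elements.

Section AdditiveTensor.
Context {M : smcat} (M_right_exact : tensor_right_exact M).
Implicit Types X Y W : M.

(** Right exactness includes additivity of [- ⊗ Y]; factoring through [h ⊠ idm Y] isolates the
    factor that varies. *)
Lemma tensDl X X' Y Y' (f f' : hom X X') (g : hom Y Y') :
  hplus f f' ⊠ g = hplus (f ⊠ g) (f' ⊠ g).
Proof.
have [_ [add _]] := M_right_exact Y.
have e (h : hom X X') : h ⊠ g = (idm X' ⊠ g) ∘ (h ⊠ idm Y).
  by rewrite -tensM comp1m compm1.
by rewrite e [f ⊠ g]e [f' ⊠ g]e -compDrE; congr (_ ∘ _); apply: add.
Qed.
Lemma tensDr X X' Y Y' (f : hom X X') (g g' : hom Y Y') :
  f ⊠ hplus g g' = hplus (f ⊠ g) (f ⊠ g').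
Proof.
have [[add _] _] := M_right_exact X.
have e (h : hom Y Y') : f ⊠ h = (f ⊠ idm Y') ∘ (idm X ⊠ h).
  by rewrite -tensM comp1m compm1.
by rewrite e [f ⊠ g]e [f ⊠ g']e -compDrE; congr (_ ∘ _); apply: add.
Qed.
Lemma tens_suml X X' Y Y' k (f : 'I_k -> hom X X') (g : hom Y Y') :
  (\big[@hplus M X X'/h0]_(i < k) f i) ⊠ g
  = \big[@hplus M _ _/h0]_(i < k) (f i ⊠ g).
Proof.
apply: (big_morph (fun f => f ⊠ g)) => [f1 f2|]; first exact: tensDl.
by apply: hplus_idem0; rewrite -tensDl hplus0.
Qed.
Lemma tens_sumr X X' Y Y' k (f : hom X X') (g : 'I_k -> hom Y Y') :
  f ⊠ (\big[@hplus M Y Y'/h0]_(i < k) g i)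
  = \big[@hplus M _ _/h0]_(i < k) (f ⊠ g i).
Proof.
apply: big_morph => [f1 f2|]; first exact: tensDr.
by apply: hplus_idem0; rewrite -tensDr hplus0.
Qed.
Lemma pt_suml X Y k (x : 'I_k -> Z X) (y : Z Y) :
  pt (\big[@hplus M II X/h0]_(i < k) x i) y
  = \big[@hplus M _ _/h0]_(i < k) pt (x i) y.
Proof. by rewrite /pt tens_suml comp_suml. Qed.
Lemma pt_sumr X Y k (x : Z X) (y : 'I_k -> Z Y) :
  pt x (\big[@hplus M II Y/h0]_(i < k) y i)
  = \big[@hplus M _ _/h0]_(i < k) pt x (y i).
Proof. by rewrite /pt tens_sumr comp_suml. Qed.

End AdditiveTensor.

Local Notation "a * b" := (zmul a b) : cat_scope.

(** * The ring of elements of a monoid *)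

Section MonoidElements.
Context {M : smcat} (A : monoid M).
Implicit Types a b c : Z A.

Lemma mm_pt a b : mm ∘ pt a b = a * b.
Proof. by rewrite /pt compA. Qed.

Lemma zmulA a b c : a * (b * c) = a * b * c.
Proof.
have e : mm ∘ (mm ⊠ idm A) ∘ pt (pt a b) c
         = mm ∘ (idm A ⊠ mm) ∘ assoc A A A ∘ pt (pt a b) c by rewrite mmA.
by rewrite -!compA tens_pt assoc_pt tens_pt !mm_pt !comp1m in e.
Qed.
Lemma zmul1l a : mu * a = a.
Proof.
by rewrite -mm_pt -[mu]compm1 -[a in LHS]comp1m -tens_pt compA mm1l lun_pt compm1.
Qed.
Lemma zmul1r a : a * mu = a.
Proof.
by rewrite -mm_pt -[mu]compm1 -[a in LHS]comp1m -tens_pt compA mm1r run_pt compm1.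
Qed.
Lemma zmul_scall a b (s : Z (II : M)) : (a ∘ s) * b = a * b ∘ s.
Proof. by rewrite -!mm_pt pt_scall compA. Qed.
Lemma zmul_scalr a b (s : Z (II : M)) : a * (b ∘ s) = a * b ∘ s.
Proof. by rewrite -!mm_pt pt_scalr compA. Qed.

Lemma ltri_comp (X Y : M) a (f : hom X A) (g : hom Y X) :
  ltri a f ∘ g = ltri a (f ∘ g).
Proof. by rewrite /ltri -!compA lunV_nat (compA (a ⊠ f)) -tensM compm1. Qed.
Lemma rtri_comp (X Y : M) a (f : hom X A) (g : hom Y X) :
  rtri f a ∘ g = rtri (f ∘ g) a.
Proof. by rewrite /rtri -!compA runV_nat (compA (f ⊠ a)) -tensM compm1. Qed.
Lemma ltri_pt (X : M) a (f : hom X A) (x : Z X) : ltri a f ∘ x = a * (f ∘ x).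
Proof. by rewrite ltri_comp. Qed.
Lemma rtri_pt (X : M) a (f : hom X A) (x : Z X) : rtri f a ∘ x = (f ∘ x) * a.
Proof. by rewrite rtri_comp /rtri -lunV_unit. Qed.

Lemma monoid_map_mul (g : hom (A : M) A) a b :
  g ∘ mm = mm ∘ (g ⊠ g) -> g ∘ (a * b) = (g ∘ a) * (g ∘ b).
Proof. by move=> e; rewrite -!mm_pt compA e -compA tens_pt. Qed.

Section Sums.
Context (M_right_exact : tensor_right_exact M).
Lemma zmul_suml k (f : 'I_k -> Z A) a :
  (\big[@hplus M II A/h0]_(i < k) f i) * a = \big[@hplus M II A/h0]_(i < k) (f i * a).
Proof.
rewrite -mm_pt pt_suml // comp_sumr.
by apply: eq_bigr => i _; rewrite mm_pt.
Qed.
Lemma zmul_sumr k (f : 'I_k -> Z A) a :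
  a * (\big[@hplus M II A/h0]_(i < k) f i) = \big[@hplus M II A/h0]_(i < k) (a * f i).
Proof.
rewrite -mm_pt pt_sumr // comp_sumr.
by apply: eq_bigr => i _; rewrite mm_pt.
Qed.
End Sums.

(* Locked, as rewriting with [compA] would otherwise unfold it. *)
Fact insert_key : unit. Proof. exact: tt. Qed.
Definition insert b : hom (A ⊗ A) A :=
  locked_with insert_key (mm ∘ (idm A ⊠ ltri b (idm A))).

Lemma insert_pt b p q : insert b ∘ pt p q = p * b * q.
Proof. by rewrite /insert unlock -compA tens_pt ltri_pt !comp1m mm_pt zmulA. Qed.

End MonoidElements.

(** * Full faithfulness and separation by elements *)

Lemma iso_epi (C : category) (X Y : C) (f : hom X Y) : is_iso f -> is_epi f.
Proof. by case=> g [_ fg] T a b e; rewrite -[a]compm1 -[b]compm1 -fg !compA e. Qed.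
Lemma iso_mono (C : category) (X Y : C) (f : hom X Y) : is_iso f -> is_mono f.
Proof. by case=> g [gf _] T a b e; rewrite -[a]comp1m -[b]comp1m -gf -!compA e. Qed.

Section Equivalence.
Context (C D : category) (F : functor C D) (F_equiv : is_equivalence F).

Lemma equivalence_faithful X Y (f g : hom X Y) : fmap F f = fmap F g -> f = g.
Proof.
have [G [[eta [eta_nat eta_iso]] _]] := F_equiv.
move=> e; apply: (iso_epi (eta_iso X)).
by have := eta_nat _ _ f; have := eta_nat _ _ g; rewrite /= e => -> ->.
Qed.

Lemma equivalence_full X Y (phi : hom (F X) (F Y)) :
  exists f : hom X Y, fmap F f = phi.
Proof.
have [G [[eta [eta_nat eta_iso]] [eps [eps_nat eps_iso]]]] := F_equiv.
have G_faithful U V (f g : hom U V) : fmap G f = fmap G g -> f = g.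
  move=> e; apply: (iso_epi (eps_iso U)).
  by have := eps_nat _ _ f; have := eps_nat _ _ g; rewrite /= e => -> ->.
have [k [kK _]] := eta_iso X.
(* Conjugating [G phi] by the natural isomorphism [eta] is the only possible preimage. Since [G] is
   faithful too, the equality with [phi] can be checked after [G]. *)
exists (eta Y ∘ fmap G phi ∘ k); apply: G_faithful.
apply: (iso_mono (eta_iso Y)).
have /= -> := eta_nat _ _ (eta Y ∘ fmap G phi ∘ k).
by rewrite -!compA kK compm1.
Qed.

End Equivalence.

Section Separation.
Context {M : smcat} (M_faithful : Z_faithful M).

(** Stronger than what faithfulness of [Z] gives at once: testing on elementary tensors is enough,
    without all elements of [X ⊗ Y]. *)
Definition separating (X : M) : Prop :=
  forall (Y W : M) (f g : hom (X ⊗ Y) W),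
    (forall (x : Z X) (y : Z Y), f ∘ pt x y = g ∘ pt x y) -> f = g.

(** For fixed [y], the maps agree on A because [Z] is faithful. Hence the adjoint transposes from
    [Y] agree on every element [y], so they are equal, and a map is recovered from its transpose. *)
Lemma separating_internal_hom (A : monoid M) :
  has_left_internal_hom A -> separating A.
Proof.
case=> G [eta [eps [eta_nat eps_nat trF _]]] Y W f g fg.
have fgy (y : Z Y) : f ∘ (idm A ⊠ y) = g ∘ (idm A ⊠ y).
  apply: (can_compr (runK A)); apply: M_faithful => a.
  rewrite /Z_map -!compA runV_pt tens_pt comp1m compm1.
  exact: fg.
have : fmap G f ∘ eta Y = fmap G g ∘ eta Y.
  apply: M_faithful => y; rewrite /Z_map -!compA.
  rewrite -[y]/(fmap (id_functor M) y) eta_nat /= !compA -!fmapM.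
  by congr (fmap _ _ ∘ _); apply: fgy.
move=> e; have adj (h : hom (A ⊗ Y) W) :
    h = eps W ∘ (idm A ⊠ (fmap G h ∘ eta Y)).
  rewrite tens1M compA.
  rewrite -[idm A ⊠ fmap G h]/(fmap (comp_functor (tensL A) G) h) eps_nat /=.
  by rewrite -compA -[LHS]compm1 -[idm _]trF.
by rewrite (adj f) (adj g) e.
Qed.

Lemma separating_retract (X X' : M) (i : hom X X') (r : hom X' X) :
  r ∘ i = idm X -> separating X' -> separating X.
Proof.
move=> ri sepX' Y W f g fg.
have K : (r ⊠ idm Y) ∘ (i ⊠ idm Y) = idm _ by rewrite -tensM1 ri tens1.
apply: (can_compr K); apply: sepX' => x y.
by rewrite -!compA tens_pt.
Qed.

Section Testing.
Context (X : M) (sepX : separating X).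

(** Separation by [Y] leaves an arbitrary element [t] of [X ⊗ W]. Writing both sides as a morphism
    applied to [t] lets separation by [X] reduce to elementary tensors. *)
Lemma separated_nested Y W V (f g : hom (Y ⊗ (X ⊗ W)) V) : separating Y ->
  (forall (y : Z Y) (x : Z X) (w : Z W),
     f ∘ pt y (pt x w) = g ∘ pt y (pt x w)) -> f = g.
Proof.
move=> sepY fg; apply: sepY => y t.
have e (h : hom (Y ⊗ (X ⊗ W)) V) t' :
    h ∘ pt y t' = h ∘ (y ⊠ idm _) ∘ lunV _ ∘ t'.
  by rewrite -!compA lunV_pt tens_pt compm1 comp1m.
rewrite !e; congr (_ ∘ t); apply: sepX => x w.
by rewrite -!e.
Qed.

Lemma separated_nestedl Y W V (f g : hom (X ⊗ W ⊗ Y) V) : separating Y ->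
  (forall (x : Z X) (w : Z W) (y : Z Y),
     f ∘ pt (pt x w) y = g ∘ pt (pt x w) y) -> f = g.
Proof.
move=> sepY fg; apply: (can_compr (symK (X ⊗ W) Y)).
apply: separated_nested => // y x w.
by rewrite -!compA sym_pt.
Qed.
End Testing.
End Separation.

(** * Casimir elements of an Azumaya monoid *)

Section Azumaya.
Context {M : smcat} (M_right_exact : tensor_right_exact M).
Context (M_faithful : Z_faithful M) (A : monoid M).
Context (A_azumaya : is_azumaya A) (sepA : separating A).
Implicit Types a b c : Z A.

Lemma free_bimod_full (X Y : M) (phi : hom (A ⊗ X) (A ⊗ Y)) :
  @is_bimod_map M A (free_bimod A X) (free_bimod A Y) phi ->
  exists f : hom X Y, idm A ⊠ f = phi.
Proof.
move=> Hphi; have [f ef] := equivalence_full A_azumaya.1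
  (exist _ phi Hphi : @hom (Bimod A) (free_bimod A X) (free_bimod A Y)).
by exists f; have := congr1 sval ef.
Qed.

Lemma tens_azumaya_faithful (X Y : M) (f g : hom X Y) :
  idm A ⊠ f = idm A ⊠ g -> f = g.
Proof.
move=> e; apply: (equivalence_faithful A_azumaya.1).
exact: bimod_homP.
Qed.

(** The composite m (A ⊗ mu) is the invertible [run A], so mu f = mu g gives A ⊗ f = A ⊗ g, and
    [A ⊗ -] is faithful. *)
Lemma mu_mono : is_mono (@mu M A).
Proof.
move=> T f g e; apply: tens_azumaya_faithful.
apply: (can_compl (runK A)); rewrite -mm1r -!compA -!tens1M.
by rewrite e.
Qed.

(** Centrality of the values of [j] makes a ⊗ x |-> a j(x) a bimodule map from A ⊗ C to A ⊗ II.
    Fullness writes it as A ⊗ h, and a = 1 gives mu h = j. *)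
Lemma central_map_factor (C : M) (j : hom C A) :
  (forall a (x : Z C), a * (j ∘ x) = (j ∘ x) * a) ->
  exists h : hom C II, mu ∘ h = j.
Proof.
move=> jC; have [phi phiE] : exists phi : hom (A ⊗ C) (A ⊗ II),
    forall a (x : Z C), phi ∘ pt a x = pt (a * (j ∘ x)) (idm II).
  exists (runV A ∘ mm ∘ (idm A ⊠ j)) => a x.
  by rewrite -!compA tens_pt mm_pt runV_pt comp1m.
have [|f ef] := @free_bimod_full C II phi.
  split=> /=.
    apply: (separated_nested sepA sepA) => a b x.
    rewrite -!compA assocV_pt !tens_pt mm_pt !comp1m !phiE assocV_pt tens_pt.
    by rewrite !mm_pt comp1m zmulA.
  apply: (separated_nestedl sepA sepA) => a x b.
  rewrite -!compA swap_last_pt !tens_pt mm_pt !comp1m !phiE swap_last_pt tens_pt.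
  by rewrite !mm_pt comp1m -zmulA jC zmulA.
exists f; apply: M_faithful => x; rewrite /Z_map -compA -run_pt.
rewrite -[mu]comp1m -tens_pt ef phiE run_pt zmul1l compm1.
by [].
Qed.

Lemma central_factor c : (forall a, a * c = c * a) -> exists s, c = mu ∘ s.
Proof.
move=> cC; have [|h <-] := @central_map_factor II c; last by exists h.
by move=> a x; rewrite zmul_scalr zmul_scall cC.
Qed.

Lemma lact_outer_pt a p q : lact (outer_bimod A) ∘ pt a (pt p q) = pt (a * p) q.
Proof. by rewrite /= -compA assocV_pt tens_pt mm_pt comp1m. Qed.
Lemma ract_outer_pt a p q : ract (outer_bimod A) ∘ pt (pt p q) a = pt p (q * a).
Proof. by rewrite /= -compA assoc_pt tens_pt mm_pt comp1m. Qed.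

(** Exchanges the roles of parameter and argument: for a fixed tensor [t], the element t' b t''
    becomes a morphism applied to [b]. *)
Lemma insert_joint b (t : Z (A ⊗ A)) :
  mm ∘ (idm A ⊠ mm) ∘ assoc A A A ∘ swap_last A A A ∘ pt t b = insert b ∘ t.
Proof.
have -> : insert b = mm ∘ (idm A ⊠ mm) ∘ assoc A A A ∘ swap_last A A A
                     ∘ (idm _ ⊠ b) ∘ runV _.
  apply: sepA => p q; rewrite insert_pt -!compA runV_pt tens_pt.
  rewrite compm1 comp1m swap_last_pt assoc_pt tens_pt !mm_pt comp1m.
  by rewrite zmulA.
by rewrite -!compA runV_pt tens_pt compm1 comp1m.
Qed.

Lemma sandwich_ex (t : Z (A ⊗ A)) :
  exists s : hom (A : M) A, forall b, s ∘ b = insert b ∘ t.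
Proof.
exists (mm ∘ (idm A ⊠ mm) ∘ assoc A A A ∘ swap_last A A A
        ∘ (t ⊠ idm A) ∘ lunV A).
by move=> b; rewrite -insert_joint -!compA lunV_pt tens_pt compm1 comp1m.
Qed.

Section Twist.
Context (al be : hom (A : M) A).
Context (alM : al ∘ mm = mm ∘ (al ⊠ al)) (beM : be ∘ mm = mm ∘ (be ⊠ be)).

(** For t = p ⊗ q this is al(a p) b be(q) = al(a) al(p) b be(q). Since [t] need not be elementary,
    both sides are first written as morphisms applied to [t]. *)
Lemma insert_lact a b (t : Z (A ⊗ A)) :
  insert b ∘ ((al ⊠ be) ∘ (lact (outer_bimod A) ∘ pt a t))
  = (al ∘ a) * (insert b ∘ ((al ⊠ be) ∘ t)).
Proof.
rewrite -ltri_pt; have := lact_outer_pt a.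
move: (lact (outer_bimod A)) => /= L LE.
have -> : pt a t = (a ⊠ idm _) ∘ lunV _ ∘ t.
  by rewrite -compA lunV_pt tens_pt compm1 comp1m.
rewrite !compA; congr (_ ∘ t); apply: sepA => p q.
rewrite -[in RHS]compA tens_pt ltri_pt insert_pt.
rewrite -!compA lunV_pt tens_pt compm1 comp1m LE tens_pt.
by rewrite insert_pt monoid_map_mul // !zmulA.
Qed.

Lemma insert_ract a b (t : Z (A ⊗ A)) :
  insert b ∘ ((al ⊠ be) ∘ (ract (outer_bimod A) ∘ pt t a))
  = (insert b ∘ ((al ⊠ be) ∘ t)) * (be ∘ a).
Proof.
rewrite -rtri_pt; have := ract_outer_pt a.
move: (ract (outer_bimod A)) => /= L LE.
have -> : pt t a = (idm _ ⊠ a) ∘ runV _ ∘ t.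
  by rewrite -compA runV_pt tens_pt compm1 comp1m.
rewrite !compA; congr (_ ∘ t); apply: sepA => p q.
rewrite -[in RHS]compA tens_pt rtri_pt insert_pt.
rewrite -!compA runV_pt tens_pt compm1 comp1m LE tens_pt.
by rewrite insert_pt monoid_map_mul // !zmulA.
Qed.

Definition intertwines (x : Z A) : Prop :=
  forall a, (al ∘ a) * x = x * (be ∘ a).

(** On p ⊗ q: al(p) x be(q) = x be(p) be(q) = x be(p q). *)
Lemma insert_intertwiner x (t : Z (A ⊗ A)) : intertwines x ->
  insert x ∘ ((al ⊠ be) ∘ t) = x * (be ∘ (mm ∘ t)).
Proof.
move=> xP; rewrite -ltri_pt !compA; congr (_ ∘ t).
apply: sepA => p q.
rewrite -[in RHS]compA ltri_pt -!compA tens_pt insert_pt mm_pt.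
by rewrite monoid_map_mul // xP zmulA.
Qed.

(** The element e = g(1) is Casimir, as a e = g(a) = e a. Inserting [b] turns the left action into
    multiplication by al(a) on the left and the right one into be(a) on the right. *)
Lemma insert_casimir g b :
  @is_bimod_map M A (regular_bimod A) (outer_bimod A) g ->
  intertwines (insert b ∘ ((al ⊠ be) ∘ (g ∘ mu))).
Proof.
case=> gl gr c; rewrite -insert_lact -insert_ract; congr (_ ∘ (_ ∘ _)).
transitivity (g ∘ c).
  rewrite -[c in LHS]comp1m -tens_pt compA -gl -compA [lact _ ∘ _]mm_pt.
  by rewrite zmul1r.
rewrite -[c in RHS]comp1m -tens_pt compA -gr -compA [ract _ ∘ _]mm_pt.
by rewrite zmul1l.
Qed.

End Twist.

(* The bimodule map [a ⊗ b |-> a e' b e''] attached to the Casimir element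
   [e = g 1] has the form [A ⊗ rho] since [A ⊗ -] is full. *)
Lemma casimir_functional (g : hom (A : M) (A ⊗ A)) :
  @is_bimod_map M A (regular_bimod A) (outer_bimod A) g ->
  exists rho : hom (A : M) II, forall a b, a ∘ (rho ∘ b) = insert b ∘ (g ∘ a).
Proof.
case=> gl gr.
have [h hE] : exists h : hom (A ⊗ A) A,
    forall a b, h ∘ pt a b = insert b ∘ (g ∘ a).
  exists (mm ∘ (idm A ⊠ mm) ∘ assoc A A A ∘ swap_last A A A
          ∘ (g ⊠ idm A)) => a b.
  by rewrite -compA tens_pt comp1m insert_joint.
have id_mul : idm (A : M) ∘ mm = mm ∘ (idm (A : M) ⊠ idm (A : M)).
  by rewrite tens1 comp1m compm1.
have hl a b c : h ∘ pt (a * b) c = a * (h ∘ pt b c).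
  have := @insert_lact (idm A) (idm A) id_mul a c (g ∘ b).
  rewrite tens1 !comp1m !hE => <-.
  by rewrite -mm_pt (compA g) gl -compA tens_pt comp1m.
have hr a b c : h ∘ pt (a * b) c = (h ∘ pt a c) * b.
  have := @insert_ract (idm A) (idm A) id_mul b c (g ∘ a).
  rewrite tens1 !comp1m !hE => <-.
  by rewrite -mm_pt (compA g) gr -compA tens_pt comp1m.
have [|rho erho] := @free_bimod_full A II (runV A ∘ h).
  split=> /=.
    apply: (separated_nested sepA sepA) => a b x.
    rewrite -!compA assocV_pt !tens_pt mm_pt !comp1m hl -!compA !runV_pt.
    by rewrite assocV_pt tens_pt mm_pt comp1m.
  apply: (separated_nestedl sepA sepA) => a x b.
  rewrite -!compA swap_last_pt !tens_pt mm_pt !comp1m hr -!compA !runV_pt.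
  by rewrite swap_last_pt tens_pt mm_pt comp1m.
exists rho => a b.
rewrite -run_pt -[a in LHS]comp1m -tens_pt erho -!compA -hE.
by rewrite (compA (run A)) runVK comp1m.
Qed.

End Azumaya.

(** * Dual bases *)

Section FinGen.
Context {M : smcat} (M_right_exact : tensor_right_exact M).
Implicit Types X Y : M.

(** A dual basis, the form of finite projectivity that expands every element of [X ⊗ Y] into
    elementary tensors. *)
Definition fin_projective X : Prop :=
  exists k (x : 'I_k -> Z X) (xi : 'I_k -> hom X II),
    \big[@hplus M X X/h0]_(i < k) (x i ∘ xi i) = idm X.

Lemma fin_projective_retract X Y (i : hom X Y) (r : hom Y X) :
  r ∘ i = idm X -> fin_projective Y -> fin_projective X.
Proof.
move=> ri [k [y [eta e]]]; exists k, (fun j => r ∘ y j), (fun j => eta j ∘ i).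
rewrite -ri -[r in RHS]compm1 -e comp_sumr comp_suml.
by apply: eq_bigr => j _; rewrite !compA.
Qed.

Lemma fin_projective_pt X Y (t : Z (X ⊗ Y)) : fin_projective X ->
  exists k (x : 'I_k -> Z X) (y : 'I_k -> Z Y),
    t = \big[@hplus M II (X ⊗ Y)/h0]_(i < k) pt (x i) (y i).
Proof.
(* The second components are the contractions of [t] with the dual basis functionals. *)
case=> k [x [xi e]]; exists k, x, (fun i => lun Y ∘ (xi i ⊠ idm Y) ∘ t).
rewrite -[LHS]comp1m -tens1 -e tens_suml // comp_suml.
apply: eq_bigr => i _.
have -> (y : Z Y) : pt (x i) y = (x i ⊠ idm Y) ∘ lunV Y ∘ y.
  by rewrite -compA lunV_pt tens_pt compm1 comp1m.
rewrite !compA -(compA _ (lunV Y)) lunK compm1 -tensM compm1.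
by [].
Qed.

End FinGen.

(** * Consequences of separability and of [A ⊗ A | A] *)

Section Azumaya.
Context {M : smcat} (M_abelian : is_abelian (sm_preadd M)).
Context (M_right_exact : tensor_right_exact M).
Context (M_faithful : Z_faithful M) (A : monoid M).
Context (A_azumaya : is_azumaya A) (sepA : separating A).
Context (A_div : bimod_divides (outer_bimod A) (regular_bimod A)).
Implicit Types a b c : Z A.

(** The Casimir elements e_i = g_i(1) are kept as bimodule maps, so that g_i(z_i) can be read both
    as z_i e_i and as e_i z_i. *)
Lemma unit_tensor_decomposition :
  exists k (z : 'I_k -> Z A) (g : 'I_k -> hom (A : M) (A ⊗ A)),
    (1 <= k)%N /\
    (forall i, @is_bimod_map M A (regular_bimod A) (outer_bimod A) (g i)) /\
    \big[@hplus M II (A ⊗ A)/h0]_(i < k) (g i ∘ z i) = pt mu mu.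
Proof.
have [k [f [g [k_gt0 _ gP e]]]] := A_div.
exists k, (fun i => f i ∘ pt mu mu), g; split=> //; split=> //.
rewrite -[RHS]comp1m -[idm _]e comp_suml.
by apply: eq_bigr => i _; rewrite compA.
Qed.

(** Inserting [b] into the decomposition of 1 ⊗ 1 gives [b] on one side and the sum of z_i rho_i(b)
    on the other. *)
Lemma azumaya_fin_projective : fin_projective (A : M).
Proof.
have [k [z [g [_ [gP e]]]]] := unit_tensor_decomposition.
have /fin_all_exists[rho rhoE] i := casimir_functional A_azumaya sepA (gP i).
exists k, z, rho; apply: M_faithful => b; rewrite /Z_map comp_suml.
transitivity (insert b ∘ pt mu mu); last by rewrite insert_pt zmul1l zmul1r comp1m.
rewrite -e comp_sumr.
by apply: eq_bigr => i _; rewrite -rhoE compA.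
Qed.

(** For a section [s] of m, the functional [rho] satisfies mu rho(1) = m(s(1)) = 1, and [mu] can be
    cancelled. *)
Lemma unit_retraction : exists rho : hom (A : M) II, rho ∘ mu = idm II.
Proof.
have [s [sP ms]] := A_azumaya.2.
have [rho rhoE] := casimir_functional A_azumaya sepA sP.
exists rho; apply: (mu_mono A_azumaya); rewrite rhoE compm1.
have -> : insert mu = @mm M A.
  by apply: sepA => p q; rewrite insert_pt mm_pt zmul1r.
by rewrite compA ms comp1m.
Qed.

(** Take pi(b) = al(p') b be(p'') with p = s(1) for a section [s] of m: the Casimir property makes
    the values intertwiners, and p' p'' = 1 fixes every intertwiner. *)
Lemma twisted_projection (al be : hom (A : M) A) :
  al ∘ mm = mm ∘ (al ⊠ al) -> be ∘ mm = mm ∘ (be ⊠ be) -> be ∘ mu = mu ->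
  exists pi : hom (A : M) A, (forall b, intertwines al be (pi ∘ b)) /\
    (forall x, intertwines al be x -> pi ∘ x = x).
Proof.
move=> alM beM be1; have [s [sP ms]] := A_azumaya.2.
have [pi piE] := sandwich_ex sepA ((al ⊠ be) ∘ (s ∘ mu)).
exists pi; split=> [b | x xP]; rewrite piE; first exact: insert_casimir.
by rewrite insert_intertwiner // (compA mm) ms comp1m be1 zmul1r.
Qed.

Lemma intertwiner_object (al be : hom (A : M) A) :
  al ∘ mm = mm ∘ (al ⊠ al) -> be ∘ mm = mm ∘ (be ⊠ be) -> be ∘ mu = mu ->
  exists (X : M) (i : hom X A) (r : hom (A : M) X), r ∘ i = idm X /\
    forall x, intertwines al be x <-> exists x', x = i ∘ x'.
Proof.
move=> alM beM be1; have [pi [piP pi_id]] := twisted_projection alM beM be1.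
have pi_idem : pi ∘ pi = pi.
  by apply: M_faithful => b; rewrite /Z_map -compA pi_id.
(* The idempotent [pi] is split by realising its image as the kernel of [pi] minus the identity. *)
have [X [i [ei iU]]] := abelian_ker M_abelian (hminus pi (idm _)).
have pi_i : pi ∘ i = i.
  apply/hminus_eq0; rewrite -[X in hminus _ X]comp1m -compBl ei; exact: comp0m.
have [|r [er _]] := iU _ pi.
  rewrite compBl pi_idem comp1m [RHS]comp0m; exact/hminus_eq0.
exists X, i, r; split.
  have [|f [_ fU]] := iU _ i; first by rewrite ei !comp0m.
  by rewrite -[LHS]fU ?compA ?er // -[RHS]fU // compm1.
move=> x; split=> [/pi_id <- | [x' ->]].
  by exists (r ∘ x); rewrite compA er.
by rewrite -pi_i -compA; apply: piP.
Qed.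

(** Here b_i = ga(e_i') e_i'' and c_i = p' z_i ga(p''). Moving b_i past p' gives b_i c_i = ga(p')
    b_i z_i ga(p''). The b_i z_i sum to ga(1) 1 = 1 because the e_i z_i sum to 1 ⊗ 1, and what
    remains is ga(p' p'') = 1. *)
Lemma twisted_unit_decomposition (ga : hom (A : M) A) :
  ga ∘ mm = mm ∘ (ga ⊠ ga) -> ga ∘ mu = mu ->
  exists k (b c : 'I_k -> Z A), (1 <= k)%N /\
    [/\ forall i, intertwines ga (idm A) (b i),
        forall i, intertwines (idm A) ga (c i)
      & \big[@hplus M II A/h0]_(i < k) (b i * c i) = mu].
Proof.
move=> gaM ga1; have [s [sP ms]] := A_azumaya.2.
have idM : idm (A : M) ∘ mm = mm ∘ (idm (A : M) ⊠ idm (A : M)).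
  by rewrite tens1 comp1m compm1.
have [k [z [g [k_gt0 [gP e]]]]] := unit_tensor_decomposition.
pose b i := insert mu ∘ ((ga ⊠ idm _) ∘ (g i ∘ mu)).
pose c i := insert (z i) ∘ ((idm _ ⊠ ga) ∘ (s ∘ mu)).
have bP i : intertwines ga (idm A) (b i) by apply: insert_casimir => //; exact: gP.
have cP i : intertwines (idm A) ga (c i) by exact: insert_casimir.
have bz i : b i * z i = insert mu ∘ ((ga ⊠ idm _) ∘ (g i ∘ z i)).
  have := @insert_ract _ _ sepA ga (idm A) idM (z i) mu (g i ∘ mu).
  rewrite comp1m => <-; congr (_ ∘ (_ ∘ _)).
  case: (gP i) => _ gr; rewrite -[z i in LHS]comp1m -tens_pt compA -gr -compA.
  by rewrite [_ ∘ pt mu _]mm_pt zmul1l.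
exists k, b, c; split=> //; split=> //.
have [pi piE] := sandwich_ex sepA ((ga ⊠ ga) ∘ (s ∘ mu)).
have mu_ga : intertwines ga ga mu by move=> x; rewrite zmul1l zmul1r.
have pi1 : pi ∘ mu = mu.
  by rewrite piE insert_intertwiner // zmul1l (compA mm) ms comp1m.
have bcE i : b i * c i = pi ∘ (b i * z i).
  rewrite piE /c -ltri_pt !compA; congr (_ ∘ _ ∘ _).
  apply: sepA => p q; rewrite -[in LHS]compA tens_pt ltri_pt insert_pt.
  by rewrite -[in RHS]compA tens_pt insert_pt comp1m !zmulA bP comp1m.
under eq_bigr do rewrite bcE bz.
rewrite -!comp_sumr e tens_pt comp1m ga1 insert_pt !zmul1l.
exact: pi1.
Qed.

End Azumaya.

(** * Invertible subobjects and automorphisms *)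

Section TwistObjects.
Context {M : smcat} (M_abelian : is_abelian (sm_preadd M)).
Context (M_right_exact : tensor_right_exact M).
Context (M_faithful : Z_faithful M) (A : monoid M).
Context (A_azumaya : is_azumaya A) (sepA : separating A).
Context (A_div : bimod_divides (outer_bimod A) (regular_bimod A)).
Implicit Types a b c : Z A.

(* The paper's object {}_σ J_δ for [σ = Z_map al] and [δ = Z_map be], together
   with the fact that it is a retract of [A]. *)
Definition twist_object (al be : hom (A : M) A) (X : over (A : M)) : Prop :=
  (exists r : hom (A : M) (odom X), r ∘ omap X = idm (odom X)) /\
  forall c, intertwines al be c <-> exists x, c = omap X ∘ x.

Lemma retraction_mono (X Y : M) (i : hom X Y) (r : hom Y X) :
  r ∘ i = idm X -> is_mono i.
Proof. by move=> ri T f g e; rewrite -[f]comp1m -[g]comp1m -ri -!compA e. Qed.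

Lemma twist_object_factor al be (X : over (A : M)) (T : M) (t : hom T A) :
  twist_object al be X -> (forall y : Z T, intertwines al be (t ∘ y)) ->
  exists h : hom T (odom X), omap X ∘ h = t.
Proof.
move=> [[r rK] XP] tP; exists (r ∘ t); apply: M_faithful => y.
have /XP[x ex] := tP y.
by rewrite /Z_map -!compA ex (compA r) rK comp1m.
Qed.

Lemma twist_object_iso al be (X X' : over (A : M)) :
  twist_object al be X -> twist_object al be X' -> over_iso X X'.
Proof.
move=> XT X'T.
have [|h hE] := @twist_object_factor _ _ _ _ (omap X) X'T.
  by move=> x; apply/XT.2; exists x.
have [|h' h'E] := @twist_object_factor _ _ _ _ (omap X') XT.
  by move=> x; apply/X'T.2; exists x.
have [[r rK] _] := XT; have [[r' r'K] _] := X'T.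
exists h; split=> //; exists h'; split.
  by apply: (retraction_mono rK); rewrite compA h'E hE compm1.
by apply: (retraction_mono r'K); rewrite compA hE h'E compm1.
Qed.

Lemma twist_object_over_iso al be (X X' : over (A : M)) :
  over_iso X X' -> twist_object al be X -> twist_object al be X'.
Proof.
move=> [h [[h' [h'h hh']] hE]] [[r rK] XP].
have h'E : omap X' = omap X ∘ h' by rewrite -hE -compA hh' compm1.
split; first by exists (h ∘ r); rewrite h'E compA -(compA h) rK compm1.
move=> c; rewrite XP; split=> [[x ->] | [x ->]].
  by exists (h ∘ x); rewrite compA hE.
by exists (h' ∘ x); rewrite h'E compA.
Qed.

Lemma twist_object_fin_projective al be X :
  twist_object al be X -> fin_projective (odom X).
Proof.
move=> [[r rK] _]; apply: (fin_projective_retract rK).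
exact: azumaya_fin_projective.
Qed.

Lemma twist_object_separating al be X :
  twist_object al be X -> separating (odom X).
Proof. by move=> [[r rK] _]; apply: (separating_retract rK). Qed.

(** Unlike [inverse_data] this is symmetric in [X] and [Y] and names both inverses, so each result
    also applies to the reversed pair. *)
Record inverse_pair (X Y : over (A : M)) (m : hom (odom X ⊗ odom Y) II)
    (mV : hom II (odom X ⊗ odom Y)) (n : hom (odom Y ⊗ odom X) II)
    (nV : hom II (odom Y ⊗ odom X)) : Prop := InversePair {
  pair_subl : is_subobject X;
  pair_subr : is_subobject Y;
  pair_mK : mV ∘ m = idm _;
  pair_mVK : m ∘ mV = idm _;
  pair_nK : nV ∘ n = idm _;
  pair_nVK : n ∘ nV = idm _;
  pair_mE : mu ∘ m = mm ∘ (omap X ⊠ omap Y);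
  pair_nE : mu ∘ n = mm ∘ (omap Y ⊠ omap X) }.

Lemma inverse_pair_sym X Y m mV n nV :
  @inverse_pair X Y m mV n nV -> @inverse_pair Y X n nV m mV.
Proof. by case. Qed.

Lemma inverse_data_pair X (W : inverse_data X) : is_subobject X ->
  exists nV, @inverse_pair X (inv_sub W) (inv_m W) (inv_mV W) (inv_n W) nV.
Proof.
case: W => Y Ysub m mV n mK mVK [nV [nK nVK]] mE nE Xsub /=.
by exists nV; split.
Qed.

Lemma inverse_pair_invertible X Y m mV n nV :
  @inverse_pair X Y m mV n nV -> is_invertible_subobject X.
Proof.
case=> Xsub Ysub mK mVK nK nVK mE nE; split=> //; constructor.
by apply: (InverseData Ysub mK mVK _ mE nE); exists nV.
Qed.

(** The formula of [Gamma_of] for any element [s] of [X ⊗ Y], so that it can be evaluated after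
    replacing [s] by a sum of elementary tensors. *)
Definition conjugation (X Y : M) (i : hom X A) (j : hom Y A) (s : Z (X ⊗ Y)) :
    hom (A : M) A :=
  mm ∘ (idm (A : M) ⊠ mm) ∘ assoc A A A ∘ ((i ⊠ idm (A : M)) ⊠ j)
  ∘ (sym A X ⊠ idm Y) ∘ assocV A X Y ∘ (idm (A : M) ⊠ s) ∘ runV A.

Lemma conjugation_sum (X Y : M) (i : hom X A) (j : hom Y A) k
    (x : 'I_k -> Z X) (y : 'I_k -> Z Y) a :
  conjugation i j (\big[@hplus M II (X ⊗ Y)/h0]_(l < k) pt (x l) (y l)) ∘ a
  = \big[@hplus M II A/h0]_(l < k) ((i ∘ x l) * (a * (j ∘ y l))).
Proof.
rewrite /conjugation -!compA runV_pt tens_pt comp1m compm1 pt_sumr //.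
rewrite !comp_sumr; apply: eq_bigr => l _.
by rewrite assocV_pt tens_pt sym_pt !tens_pt assoc_pt tens_pt !comp1m !mm_pt.
Qed.

Section InversePair.
Context X Y m mV n nV (P : @inverse_pair X Y m mV n nV).

Lemma pair_pt (x : Z (odom X)) (y : Z (odom Y)) :
  (omap X ∘ x) * (omap Y ∘ y) = mu ∘ (m ∘ pt x y).
Proof. by rewrite compA (pair_mE P) -compA tens_pt mm_pt. Qed.

Lemma pair_pt_sym (x : Z (odom X)) (y : Z (odom Y)) :
  (omap Y ∘ y) * (omap X ∘ x) = mu ∘ (n ∘ pt y x).
Proof. by rewrite compA (pair_nE P) -compA tens_pt mm_pt. Qed.

(* With [mV = x ⊗ y] in Sweedler style and [rho] a retraction of the unit, the
   retraction is [a |-> x rho(y a)]. *)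
Lemma pair_retract : exists r : hom (A : M) (odom X), r ∘ omap X = idm _.
Proof.
have [rho rho1] := unit_retraction A_azumaya sepA.
exists (run _ ∘ (idm _ ⊠ (rho ∘ mm ∘ (omap Y ⊠ idm (A : M)))) ∘ assoc _ _ _
        ∘ (mV ⊠ idm (A : M)) ∘ lunV A).
have nE : rho ∘ mm ∘ (omap Y ⊠ omap X) = n.
  by rewrite -compA -(pair_nE P) compA rho1 comp1m.
have e : omap X ∘ run _ ∘ (idm _ ⊠ n) = mm ∘ (idm (A : M) ⊠ mm)
         ∘ (omap X ⊠ (omap Y ⊠ omap X)).
  rewrite -run_nat -mm1r -!compA -!tensM !compm1 !comp1m (pair_nE P).
  by [].
(* Associativity in A: contracting x ⊗ y ⊗ x' by [n] on the right or by [m] on the left gives the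
   same element. *)
have e' : omap X ∘ run _ ∘ (idm _ ⊠ n) ∘ assoc _ _ _ = omap X ∘ lun _
         ∘ (m ⊠ idm _).
  rewrite e -[in LHS]compA -assoc_nat compA -mmA.
  rewrite -compA -tensM comp1m -(pair_mE P) -lun_nat -mm1l.
  by rewrite -!compA -!tensM !comp1m !compm1.
apply: (pair_subl P).
rewrite -!compA lunV_nat (compA (mV ⊠ _)) -tensM compm1 comp1m.
have -> : mV ⊠ omap X = ((idm _ ⊠ idm _) ⊠ omap X) ∘ (mV ⊠ idm (odom X)).
  by rewrite tens1 -tensM comp1m compm1.
rewrite !compA -(compA _ (assoc _ _ _)) assoc_nat.
rewrite -!compA (compA (_ ⊠ (rho ∘ _))) -tensM comp1m -!compA -tensM comp1m compm1.
rewrite (compA rho) nE !compA e' -(compA (omap X ∘ _)) -tensM (pair_mVK P) comp1m.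
by rewrite tens1 compm1 -(compA (omap X)) lunVK.
Qed.

Lemma pair_fin_projective : fin_projective (odom X).
Proof.
have [r rK] := pair_retract; apply: (fin_projective_retract rK).
exact: azumaya_fin_projective.
Qed.

Lemma pair_unit_sum : exists k (x : 'I_k -> Z (odom X)) (y : 'I_k -> Z (odom Y)),
  mV = \big[@hplus M II _/h0]_(l < k) pt (x l) (y l) /\
  \big[@hplus M II A/h0]_(l < k) ((omap X ∘ x l) * (omap Y ∘ y l)) = mu.
Proof.
have [k [x [y e]]] := fin_projective_pt M_right_exact mV pair_fin_projective.
exists k, x, y; split=> //.
under eq_bigr => l _ do rewrite pair_pt.
by rewrite -!comp_sumr -e (pair_mVK P) compm1.
Qed.

(** Multiply on the right by the y_l and sum, using that the x_l y_l add up to 1. *)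
Lemma pair_cancel a b :
  (forall x, a * (omap X ∘ x) = b * (omap X ∘ x)) -> a = b.
Proof.
move=> ab; have [k [x [y [_ xy1]]]] := pair_unit_sum.
rewrite -[a]zmul1r -[b]zmul1r -xy1 !zmul_sumr //.
by apply: eq_bigr => l _; rewrite !zmulA ab.
Qed.

Let ga := conjugation (omap X) (omap Y) mV.

(** Each y_l x is a scalar, so the sum of x_l a y_l x is the sum of x_l (y_l x) a, which is x a. *)
Lemma conjugation_left a x : (ga ∘ a) * (omap X ∘ x) = (omap X ∘ x) * a.
Proof.
have [k [x' [y' [e xy1]]]] := pair_unit_sum.
rewrite /ga e conjugation_sum zmul_suml //.
rewrite -[omap X ∘ x in RHS]zmul1l -xy1 !zmul_suml //; apply: eq_bigr => l _.
rewrite -!zmulA pair_pt_sym; congr (_ * _).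
by rewrite zmulA pair_pt_sym zmul_scalr zmul_scall zmul1l zmul1r.
Qed.

Lemma conjugation_right a y : (omap Y ∘ y) * (ga ∘ a) = a * (omap Y ∘ y).
Proof.
have [k [x' [y' [e xy1]]]] := pair_unit_sum.
rewrite /ga e conjugation_sum zmul_sumr //.
rewrite -[omap Y ∘ y in RHS]zmul1r -xy1 !zmul_sumr //; apply: eq_bigr => l _.
rewrite !zmulA -(zmulA a) pair_pt_sym; congr (_ * _).
by rewrite zmul_scall zmul_scalr zmul1l zmul1r.
Qed.

Lemma conjugation_unit : ga ∘ mu = mu.
Proof. by apply: pair_cancel => x; rewrite conjugation_left zmul1l zmul1r. Qed.

(** It suffices to compare after multiplying by x in [X], where ga(a) ga(b) x = ga(a) x b = x a b =
    ga(a b) x. *)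
Lemma conjugation_mul : ga ∘ mm = mm ∘ (ga ⊠ ga).
Proof.
apply: sepA => a b; rewrite -(compA ga) -(compA mm) tens_pt !mm_pt.
apply: pair_cancel => x.
rewrite -(zmulA (ga ∘ a)) !conjugation_left (zmulA (ga ∘ a)) conjugation_left.
by rewrite zmulA.
Qed.

End InversePair.

Lemma conjugation_aut X Y m mV n nV : @inverse_pair X Y m mV n nV ->
  is_monoid_aut (conjugation (omap X) (omap Y) mV).
Proof.
move=> P; have Q := inverse_pair_sym P.
split; [| exact: (conjugation_mul P) | exact: (conjugation_unit P)].
(* The inverse is conjugation by the reversed pair. *)
exists (conjugation (omap Y) (omap X) nV).
split; apply: M_faithful => a; rewrite /Z_map -compA comp1m.
  apply: (pair_cancel Q) => y.
  by rewrite (conjugation_left Q) (conjugation_right P).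
apply: (pair_cancel P) => x.
by rewrite (conjugation_left P) (conjugation_right Q).
Qed.

(** If ga(a) c = c a for all a, then a y_l c = y_l ga(a) c = y_l c a. So y_l c is a scalar s_l, and
    c is the sum of the x_l s_l, an element of [X]. *)
Lemma conjugation_twist_object X Y m mV n nV :
  @inverse_pair X Y m mV n nV ->
  twist_object (conjugation (omap X) (omap Y) mV) (idm A) X.
Proof.
move=> P; split; first exact: (pair_retract P).
move=> c; split=> [cP | [x ->] a]; last first.
  by rewrite (conjugation_left P) comp1m.
have [k [x [y [_ xy1]]]] := pair_unit_sum P.
have /fin_all_exists[s sE] l : exists s, (omap Y ∘ y l) * c = mu ∘ s.
  apply: central_factor => // a.
  by rewrite zmulA -(conjugation_right P) -!zmulA cP comp1m.
exists (\big[@hplus M II _/h0]_(l < k) (x l ∘ s l)).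
rewrite comp_sumr -[LHS]zmul1l -xy1 zmul_suml //; apply: eq_bigr => l _.
by rewrite -zmulA sE zmul_scalr zmul1r compA.
Qed.

Lemma twist_object_unique X Y m mV n nV al al' :
  @inverse_pair X Y m mV n nV ->
  twist_object al (idm A) X -> twist_object al' (idm A) X -> al = al'.
Proof.
move=> P XT XT'; apply: M_faithful => a; apply: (pair_cancel P) => x.
rewrite /Z_map.
have -> : (al ∘ a) * (omap X ∘ x) = (omap X ∘ x) * (idm A ∘ a).
  by apply: (proj2 (XT.2 _)); exists x.
by apply/esym; apply: (proj2 (XT'.2 _)); exists x.
Qed.

(* The dual basis argument: [x ⊗ y = x ⊗ (y x_l) y_l = (x y) x_l ⊗ y_l]. *)
Lemma pair_section (X Y : over (A : M)) m n (s : Z (odom X ⊗ odom Y)) :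
  is_mono (omap X) -> is_mono (omap Y) ->
  fin_projective (odom X) -> separating (odom X) ->
  mu ∘ m = mm ∘ (omap X ⊠ omap Y) -> mu ∘ n = mm ∘ (omap Y ⊠ omap X) ->
  m ∘ s = idm II -> s ∘ m = idm _.
Proof.
move=> Xm Ym Xfp Xsep mE nE ms; apply: Xsep => x y.
have [k [x' [y' e]]] := fin_projective_pt M_right_exact s Xfp.
have xyE u v : (omap X ∘ u) * (omap Y ∘ v) = mu ∘ (m ∘ pt u v).
  by rewrite compA mE -compA tens_pt mm_pt.
have yxE u v : (omap Y ∘ v) * (omap X ∘ u) = mu ∘ (n ∘ pt v u).
  by rewrite compA nE -compA tens_pt mm_pt.
have xy1 : \big[@hplus M II A/h0]_(l < k) ((omap X ∘ x' l) * (omap Y ∘ y' l)) = mu.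
  under eq_bigr => l _ do rewrite xyE.
  by rewrite -!comp_sumr -e ms compm1.
have yE : y = \big[@hplus M II _/h0]_(l < k) (y' l ∘ (n ∘ pt y (x' l))).
  apply: Ym; rewrite comp_sumr -[LHS]zmul1r -xy1 zmul_sumr //.
  by apply: eq_bigr => l _; rewrite zmulA yxE zmul_scall zmul1l !compA.
rewrite comp1m -compA e comp_suml [in RHS]yE pt_sumr //.
apply: eq_bigr => l _; rewrite pt_scalr -!pt_scall; congr (pt _ _).
apply: Xm.
transitivity ((omap X ∘ x) * (omap Y ∘ y) * (omap X ∘ x' l)).
  by rewrite xyE zmul_scall zmul1l compA.
by rewrite -zmulA yxE zmul_scalr zmul1r !compA.
Qed.

End TwistObjects.

(** * Invertibility of twist objects, and computation of [Gamma] and [Phi] *)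

Section Inversion.
Context {M : smcat} (M_abelian : is_abelian (sm_preadd M)).
Context (M_right_exact : tensor_right_exact M).
Context (M_faithful : Z_faithful M) (A : monoid M).
Context (A_azumaya : is_azumaya A) (sepA : separating A).
Context (A_div : bimod_divides (outer_bimod A) (regular_bimod A)).
Implicit Types a b c : Z A.

Lemma id_monoid_aut : is_monoid_aut (idm (A : M)).
Proof.
split; last exact: comp1m; first by exists (idm _); rewrite comp1m.
by rewrite tens1 comp1m compm1.
Qed.

Lemma comp_monoid_aut (g f : hom (A : M) A) :
  is_monoid_aut g -> is_monoid_aut f -> is_monoid_aut (g ∘ f).
Proof.
move=> [[g' [g'g gg']] gM g1] [[f' [f'f ff']] fM f1]; split.
- exists (f' ∘ g'); split.
    by rewrite -compA (compA g') g'g comp1m.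
  by rewrite -compA (compA f) ff' comp1m.
- by rewrite -compA fM compA gM -compA tensM.
by rewrite -compA f1.
Qed.

Lemma inverse_monoid_aut (g : hom (A : M) A) : is_monoid_aut g ->
  exists g', [/\ is_monoid_aut g', g' ∘ g = idm _ & g ∘ g' = idm _].
Proof.
move=> [[g' [g'g gg']] gM g1]; exists g'; split=> //; split.
- by exists g.
- rewrite -[mm in LHS]compm1 -tens1 -gg' tensM (compA mm) -gM.
  by rewrite !compA g'g comp1m.
by rewrite -[RHS]comp1m -g'g -compA g1.
Qed.

Lemma intertwines_inverse (al al' : hom (A : M) A) c :
  al' ∘ al = idm _ -> al ∘ al' = idm _ ->
  intertwines al' (idm A) c <-> intertwines (idm A) al c.
Proof.
move=> al'K alK'; split=> cP a.
  by have := cP (al ∘ a); rewrite compA al'K !comp1m.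
by have := cP (al' ∘ a); rewrite (compA al) alK' !comp1m.
Qed.

Lemma twist_object_ex al be : is_monoid_aut al -> is_monoid_aut be ->
  exists X : over (A : M), twist_object al be X.
Proof.
move=> [_ alM _] [_ beM be1].
have [X [i [r [rK iP]]]] := intertwiner_object M_abelian M_faithful A_azumaya
  sepA alM beM be1.
by exists (Over i); split; first exists r.
Qed.

(** Products x y are central: with a = al(a'), a x y = x a' y = x y a. They therefore factor through
    the unit, and [twisted_unit_decomposition] provides the element sent to 1. That [s] is a
    two-sided inverse is left to [pair_section]. *)
Lemma twist_object_split al (X Y : over (A : M)) : is_monoid_aut al ->
  twist_object al (idm A) X -> twist_object (idm A) al Y ->
  exists m (s : Z (odom X ⊗ odom Y)),
    mu ∘ m = mm ∘ (omap X ⊠ omap Y) /\ m ∘ s = idm II.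
Proof.
move=> alA XT YT; have [[al' [_ al'K]] alM al1] := alA.
have Xsep := twist_object_separating sepA XT.
have [m mE] : exists m, mu ∘ m = mm ∘ (omap X ⊠ omap Y).
  apply: central_map_factor => // a t; rewrite -ltri_pt -rtri_pt.
  congr (_ ∘ t); apply: Xsep => x y; rewrite ltri_pt rtri_pt.
  rewrite -compA tens_pt mm_pt.
  have xP : intertwines al (idm A) (omap X ∘ x) by apply/XT.2; exists x.
  have yP : intertwines (idm A) al (omap Y ∘ y) by apply/YT.2; exists y.
  rewrite -[a]comp1m -al'K -compA zmulA xP -zmulA.
  by rewrite yP zmulA.
have [k [b [c [_ [bP cP bc1]]]]] :=
  twisted_unit_decomposition A_azumaya sepA A_div alM al1.
have /fin_all_exists[x xE] i : exists x, b i = omap X ∘ x by apply/XT.2.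
have /fin_all_exists[y yE] i : exists y, c i = omap Y ∘ y by apply/YT.2.
exists m, (\big[@hplus M II _/h0]_(i < k) pt (x i) (y i)); split=> //.
apply: (mu_mono A_azumaya); rewrite compA mE comp_sumr compm1 -bc1.
by apply: eq_bigr => i _; rewrite -compA tens_pt mm_pt xE yE.
Qed.

Lemma twist_inverse_pair al (X Y : over (A : M)) : is_monoid_aut al ->
  twist_object al (idm A) X -> twist_object (idm A) al Y ->
  exists m mV n nV, @inverse_pair M A X Y m mV n nV.
Proof.
move=> alA XT YT.
have [m [s [mE ms]]] := twist_object_split alA XT YT.
have [al' [al'A al'K alK']] := inverse_monoid_aut alA.
(* For the inverse automorphism [X] and [Y] exchange roles, which yields the second pairing [n]. *)
have YT' : twist_object al' (idm A) Y.
  by case: YT => Yr YP; split=> // c; rewrite -YP (intertwines_inverse _ al'K alK').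
have XT' : twist_object (idm A) al' X.
  by case: XT => Xr XP; split=> // c; rewrite -XP -(intertwines_inverse _ alK' al'K).
have [n [t [nE nt]]] := twist_object_split al'A YT' XT'.
have [[r rK] _] := XT; have [[r' r'K] _] := YT.
have Xm := retraction_mono rK; have Ym := retraction_mono r'K.
exists m, s, n, t; split=> //.
  apply: (pair_section M_right_exact Xm Ym _ _ mE nE ms).
    exact: (twist_object_fin_projective _ _ _ _ XT).
  exact: (twist_object_separating sepA XT).
apply: (pair_section M_right_exact Ym Xm _ _ nE mE nt).
  exact: (twist_object_fin_projective _ _ _ _ YT).
exact: (twist_object_separating sepA YT).
Qed.

Lemma twist_object_invertible al (X : over (A : M)) : is_monoid_aut al ->
  twist_object al (idm A) X -> is_invertible_subobject X.
Proof.
move=> alA XT; have [Y YT] := twist_object_ex id_monoid_aut alA.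
have [m [mV [n [nV P]]]] := twist_inverse_pair alA XT YT.
exact: (inverse_pair_invertible P).
Qed.

Lemma unit_twist_object : twist_object (idm A) (idm A) (Over (@mu M A)).
Proof.
split; first by have [rho rho1] := unit_retraction A_azumaya sepA; exists rho.
move=> c; split=> [cP | [s ->] a].
  apply: (central_factor M_faithful A_azumaya sepA) => a.
  by have := cP a; rewrite comp1m.
by rewrite comp1m zmul_scall zmul_scalr zmul1l zmul1r.
Qed.

Lemma inverse_pair_ex (X : over (A : M)) : is_invertible_subobject X ->
  exists Y m mV n nV, @inverse_pair M A X Y m mV n nV.
Proof.
case=> Xsub [W]; have [nV P] := inverse_data_pair W Xsub.
by exists (inv_sub W), (inv_m W), (inv_mV W), (inv_n W), nV.
Qed.

Lemma Gamma_twist_object (X : over (A : M)) : is_invertible_subobject X ->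
  is_monoid_aut (Gamma X) /\ twist_object (Gamma X) (idm A) X.
Proof.
move=> [Xsub [W0]].
(* As some inverse datum exists, [epsilon] returns the map of an actual one, not a default value. *)
have [W ->] : exists W : inverse_data X, Gamma X = Gamma_of W.
  by rewrite /Gamma; apply epsilon_spec; exists (Gamma_of W0), W0.
have [nV P] := inverse_data_pair W Xsub; split.
  exact: (conjugation_aut _ _ _ _ _ P).
exact: (conjugation_twist_object _ _ _ _ _ P).
Qed.

(** To compute [Gamma] it is thus enough to exhibit a twist object; independence of choices,
    multiplicativity and surjectivity are all obtained this way. *)
Lemma Gamma_unique al (X : over (A : M)) : is_invertible_subobject X ->
  twist_object al (idm A) X -> Gamma X = al.
Proof.
move=> Xinv XT; have [Y [m [mV [n [nV P]]]]] := inverse_pair_ex Xinv.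
exact: (twist_object_unique _ _ _ _ _ P (Gamma_twist_object Xinv).2 XT).
Qed.

Lemma Phi_Gamma (X : over (A : M)) : is_invertible_subobject X ->
  Phi X = Z_map (Gamma X).
Proof.
move=> Xinv; have [Xsub [W0]] := Xinv.
have [W ->] : exists W : inverse_data X, Phi X = Phi_of W.
  by rewrite /Phi; apply epsilon_spec; exists (Phi_of W0), W0.
have [nV P] := inverse_data_pair W Xsub.
(* The datum chosen for [Phi] may differ from the one chosen for [Gamma]; uniqueness makes the
   difference harmless. *)
have -> : Gamma X = Gamma_of W.
  apply: (Gamma_unique Xinv); exact: (conjugation_twist_object _ _ _ _ _ P).
have [k [x [y [e _]]]] := pair_unit_sum M_right_exact M_faithful A_azumaya sepA A_div P.
apply: functional_extensionality => t.
rewrite /Z_map -[Gamma_of W]/(conjugation _ _ _) /Phi_of e conjugation_sum //.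
rewrite comp_sumr; apply: eq_bigr => l _.
by rewrite -compA tens_pt mm_pt ltri_pt.
Qed.

Lemma inv_mult_twist_object al al' (X X' : over (A : M)) :
  is_monoid_aut al -> is_monoid_aut al' ->
  twist_object al (idm A) X -> twist_object al' (idm A) X' ->
  twist_object (al ∘ al') (idm A) (inv_mult X X').
Proof.
move=> alA al'A XT X'T.
have [Y YT] := twist_object_ex id_monoid_aut alA.
have [m [mV [n [nV P]]]] := twist_inverse_pair alA XT YT.
have [k [x [y [_ xy1]]]] := pair_unit_sum M_right_exact M_faithful A_azumaya sepA A_div P.
have [[r rK] XP] := XT; have [[r' r'K] X'P] := X'T.
have xP u : intertwines al (idm A) (omap X ∘ u) by apply/XP; exists u.
have x'P u : intertwines al' (idm A) (omap X' ∘ u) by apply/X'P; exists u.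
have yP u : intertwines (idm A) al (omap Y ∘ u) by apply/YT.2; exists u.
split.
  (* The retraction a |-> sum of x_l ⊗ r'(y_l a); on u u' it uses that y_l u is a scalar and that u
     is the sum of the x_l (y_l u). *)
  exists (\big[@hplus M _ _/h0]_(l < k)
    ((x l ⊠ (r' ∘ ltri (omap Y ∘ y l) (idm _))) ∘ lunV _)).
  apply: (separating_retract rK sepA) => u u' /=.
  rewrite comp_suml comp1m comp_suml.
  have uE : pt u u' = pt (\big[@hplus M II _/h0]_(l < k)
      (x l ∘ (n ∘ pt (y l) u))) u'.
    congr (pt _ _); apply: (pair_subl P); rewrite comp_sumr -[LHS]zmul1l -xy1.
    rewrite zmul_suml //; apply: eq_bigr => l _.
    by rewrite -zmulA (pair_pt_sym P) zmul_scalr zmul1r !compA.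
  rewrite [RHS]uE pt_suml //; apply: eq_bigr => l _.
  rewrite -!compA tens_pt mm_pt lunV_pt tens_pt compm1 pt_scall -pt_scalr.
  congr (pt _ _); rewrite -[in LHS]compA ltri_pt comp1m zmulA (pair_pt_sym P).
  by rewrite zmul_scall zmul1l -compA !compA r'K comp1m.
move=> c; split=> [cP | [t ->] a]; last first.
  rewrite comp1m -ltri_pt -rtri_pt; congr (_ ∘ t).
  apply: (twist_object_separating sepA XT) => u u'.
  rewrite ltri_pt rtri_pt /= -!compA tens_pt mm_pt zmulA xP -zmulA.
  by rewrite comp1m x'P comp1m zmulA.
(* Each y_l c lies in X' because al'(a) y_l c = y_l al(al'(a)) c = y_l c a; then c is the sum of the
   x_l (y_l c). *)
have /fin_all_exists[x' x'E] l : exists u, (omap Y ∘ y l) * c = omap X' ∘ u.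
  apply/X'P => a; have := yP (y l) (al' ∘ a); rewrite comp1m zmulA => ->.
  by rewrite -!zmulA compA cP.
exists (\big[@hplus M II _/h0]_(l < k) pt (x l) (x' l)).
rewrite comp_sumr -[LHS]zmul1l -xy1 zmul_suml //; apply: eq_bigr => l _.
by rewrite -zmulA x'E /= -compA tens_pt mm_pt.
Qed.

End Inversion.

(** * The objects J *)

Lemma iso_comp (C : category) (X Y W : C) (g : hom Y W) (f : hom X Y) :
  is_iso g -> is_iso f -> is_iso (g ∘ f).
Proof.
move=> [g' [g'g gg']] [f' [f'f ff']]; exists (f' ∘ g'); split.
  by rewrite -compA (compA g') g'g comp1m.
by rewrite -compA (compA f) ff' comp1m.
Qed.

Lemma iso_tens (M : smcat) (X X' Y Y' : M) (f : hom X X') (g : hom Y Y') :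
  is_iso f -> is_iso g -> is_iso (f ⊠ g).
Proof.
move=> [f' [f'f ff']] [g' [g'g gg']].
by exists (f' ⊠ g'); rewrite -!tensM f'f ff' g'g gg' !tens1.
Qed.

Lemma iso_idm (C : category) (X : C) : is_iso (idm X).
Proof. by exists (idm X); rewrite comp1m. Qed.

Lemma coequalizer_refl_iso (C : category) (X Y Q : C) (f : hom X Y) (q : hom Y Q) :
  is_coequalizer f f q -> is_iso q.
Proof.
case=> _ qU; have [|b [bq _]] := qU _ (idm Y); first by [].
exists b; split=> //; have [|e [eq eU]] := qU _ q; first by [].
by rewrite -(eU (idm Q)) ?comp1m // -(eU (q ∘ b)) // -compA bq compm1.
Qed.

Lemma coequalizer_refl_id (C : category) (X Y : C) (f : hom X Y) :
  is_coequalizer f f (idm Y).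
Proof.
split=> // T a _; exists a; split; first exact: compm1.
by move=> b <-; rewrite compm1.
Qed.

Lemma over_iso_refl (C : category) (A : C) (X : over A) : over_iso X X.
Proof. by exists (idm _); split; [exact: iso_idm | rewrite compm1]. Qed.

Lemma over_iso_sym (C : category) (A : C) (X Y : over A) :
  over_iso X Y -> over_iso Y X.
Proof.
move=> [h [[h' [h'h hh']] hE]]; exists h'; split; first by exists h.
by rewrite -hE -compA hh' compm1.
Qed.

Lemma over_iso_trans (C : category) (A : C) (X Y W : over A) :
  over_iso X Y -> over_iso Y W -> over_iso X W.
Proof.
move=> [h [hi hE]] [g [gi gE]]; exists (g ∘ h); split; first exact: iso_comp.
by rewrite compA gE.
Qed.

Lemma over_iso_mutual (C : category) (A : C) (X Y : over A) :
  is_mono (omap X) -> is_mono (omap Y) -> over_le X Y -> over_le Y X ->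
  over_iso X Y.
Proof.
move=> Xm Ym [h hE] [g gE]; exists h; split=> //; exists g; split.
  by apply: Xm; rewrite compA gE hE compm1.
by apply: Ym; rewrite compA hE gE compm1.
Qed.

Section JObjects.
Context {M : smcat} (M_abelian : is_abelian (sm_preadd M)) (A : monoid M).
Implicit Types (sigma delta gamma theta : Z A -> Z A) (J : over (A : M)).

Lemma equalizer_ex (X Y : M) (f g : hom X Y) :
  exists E : over X, is_equalizer f g (omap E).
Proof.
have [K [k [ek kU]]] := abelian_ker M_abelian (hminus f g).
exists (Over k); split=> /=.
  by apply/hminus_eq0; rewrite -compBl ek; exact: comp0m.
move=> T a fa; apply: kU; rewrite compBl [RHS]comp0m; exact/hminus_eq0.
Qed.

(** Replaces the family of equalizers and its intersection by a single universal property, stated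
    for all morphisms into A. *)
Lemma is_JP sigma delta J : is_J sigma delta J <->
  is_mono (omap J) /\ forall (T : M) (t : hom T A),
    (forall z, ltri (sigma z) t = rtri t (delta z)) <->
    exists h, omap J ∘ h = t.
Proof.
have actE (T : M) (t : hom T A) z : (ltri (sigma z) t = rtri t (delta z)) <->
    (ltri (sigma z) (idm A) ∘ t = rtri (idm A) (delta z) ∘ t).
  by rewrite ltri_comp rtri_comp comp1m.
split=> [[E [Eeq [Jm [JE JU]]]] | [Jm JU]].
  split=> // T t; split=> [tP | [h <-] z].
    have [|h hE] := JU (Over t); last by exists h.
    by move=> z; have [h [hE _]] := (Eeq z).2 _ t (proj1 (actE _ _ _) (tP z)); exists h.
  apply/actE; have [k <-] := JE z.
  by rewrite !compA (Eeq z).1.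
(* The definition asks for a whole family of equalizers, so one is chosen for each [z]. *)
pose EP z := constructive_indefinite_description _
  (equalizer_ex (ltri (sigma z) (idm A)) (rtri (idm A) (delta z))).
exists (fun z => sval (EP z)); split=> [z|]; first exact: (svalP (EP z)).
split=> //; split=> [z | T TE].
  have [_ EU] := svalP (EP z).
  have [|h [hE _]] := EU _ (omap J); last by exists h.
  by apply/actE; move: z {EU}; apply: (proj2 (JU _ _)); exists (idm _); rewrite compm1.
apply/(JU _ (omap T)) => z; apply/actE; have [h <-] := TE z.
by rewrite !compA (svalP (EP z)).1.
Qed.

Lemma is_J_unique sigma delta J J' :
  is_J sigma delta J -> is_J sigma delta J' -> over_iso J J'.
Proof.
move=> /is_JP[Jm JU] /is_JP[J'm J'U]; apply: over_iso_mutual => //.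
  by apply/J'U/JU; exists (idm _); rewrite compm1.
by apply/JU/J'U; exists (idm _); rewrite compm1.
Qed.

Lemma is_J_intertwines sigma delta J z (x : Z (odom J)) :
  is_J sigma delta J -> sigma z * (omap J ∘ x) = (omap J ∘ x) * delta z.
Proof.
move=> /is_JP[_ JU]; rewrite -ltri_pt -rtri_pt; congr (_ ∘ x).
by apply: (proj2 (JU _ _)); exists (idm _); rewrite compm1.
Qed.

Lemma is_J_bijective theta J : bijective theta ->
  is_J id id J -> is_J theta theta J.
Proof.
move=> [theta' thetaK theta'K] /is_JP[Jm JU]; apply/is_JP; split=> // T t.
rewrite -JU; split=> tP z; last exact: tP.
by have := tP (theta' z); rewrite theta'K.
Qed.

(** When the middle object is the unit, the two actions become the unit constraints and agree by the
    triangle axiom. The coequalizer map is then invertible, so the relative tensor product is the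
    plain one. *)
Lemma J_mult_iso_pair sigma delta gamma J J' :
  J_mult_iso sigma delta gamma -> is_J sigma delta J -> is_J delta gamma J' ->
  is_J delta delta (Over (@mu M A)) -> is_J sigma gamma (Over (@mu M A)) ->
  exists m : hom (odom J ⊗ odom J') II,
    is_iso m /\ mu ∘ m = mm ∘ (omap J ⊠ omap J').
Proof.
move=> [Jsd [Jdg [Jdd [Jsg [m [ra [la [Q [q [mbar]]]]]]]]]].
move=> [[JsdP JdgP JddP JsgP] [[mE raE laE] [qP mbarE mbar_iso]]].
move=> JP J'P mudd musg.
have [h [h_iso hE]] := is_J_unique JP JsdP.
have [h' [h'_iso h'E]] := is_J_unique J'P JdgP.
have [k [k_iso kE]] := is_J_unique mudd JddP.
have [l [l_iso lE]] := is_J_unique JsgP musg.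
have raK : ra ∘ (idm _ ⊠ k) = run _.
  apply: (proj1 (proj1 (is_JP _ _ _) JsdP)).
  rewrite compA raE -run_nat -mm1r -!compA -!tensM !comp1m !compm1 kE.
  by [].
have laK : la ∘ (k ⊠ idm _) = lun _.
  apply: (proj1 (proj1 (is_JP _ _ _) JdgP)).
  rewrite compA laE -lun_nat -mm1l -!compA -!tensM !comp1m !compm1 kE.
  by [].
have q_iso : is_iso q.
  have eE : ra ⊠ idm _ = (idm _ ⊠ la) ∘ assoc (odom Jsd) (odom Jdd) (odom Jdg).
    apply: (iso_epi (iso_tens (iso_tens (iso_idm _) k_iso) (iso_idm (odom Jdg)))).
    rewrite -tensM raK comp1m -compA assoc_nat compA -tensM comp1m laK.
    exact: esym (triangle _ _).
  by move: qP; rewrite -eE; apply: coequalizer_refl_iso.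
exists (l ∘ m ∘ (h ⊠ h')); split.
  apply: iso_comp; last exact: iso_tens.
  by rewrite -mbarE; do !apply: iso_comp.
by rewrite !compA [mu ∘ l]lE mE -compA -tensM hE h'E.
Qed.

Lemma pair_J_mult_iso sigma delta gamma J J' (m : hom (odom J ⊗ odom J') II) :
  is_J sigma delta J -> is_J delta gamma J' ->
  is_J delta delta (Over (@mu M A)) -> is_J sigma gamma (Over (@mu M A)) ->
  is_iso m -> mu ∘ m = mm ∘ (omap J ⊠ omap J') ->
  J_mult_iso sigma delta gamma.
Proof.
move=> JP J'P mudd musg m_iso mE.
exists J, J', (Over mu), (Over mu), m, (run _), (lun _), (odom J ⊗ odom J'),
  (idm _), m.
split=> //; split; first split=> //.
- by rewrite /is_J_mult -run_nat -mm1r -!compA -!tensM !comp1m !compm1.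
- by rewrite /is_J_mult -lun_nat -mm1l -!compA -!tensM !comp1m !compm1.
split=> //; last exact: compm1.
by rewrite [_ ∘ assoc _ _ _]triangle; apply: coequalizer_refl_id.
Qed.

End JObjects.

(** * The groups *)

Section AlgebraAutomorphisms.
Context {M : smcat} (A : monoid M).
Implicit Types (theta sigma tau : Z A -> Z A).

Lemma zscaleE (s : Z (II : M)) (z : Z A) : zscale s z = z ∘ s.
Proof. by rewrite -lun_pt /pt compA. Qed.

Lemma Z_map_alg_aut (ga : hom (A : M) A) :
  is_monoid_aut ga -> is_Zalg_aut (Z_map ga).
Proof.
move=> [[ga' [ga'K gaK']] gaM ga1]; split=> //.
- exists (Z_map ga') => z; rewrite /Z_map compA; first by rewrite ga'K comp1m.
  by rewrite gaK' comp1m.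
- by move=> z w; apply: compDrE.
- by move=> s z; rewrite !zscaleE /Z_map compA.
by move=> z w; apply: monoid_map_mul.
Qed.

Lemma Z_map_comp (X Y W : M) (g : hom Y W) (f : hom X Y) :
  Z_map (g ∘ f) = Z_map g \o Z_map f.
Proof. by apply: functional_extensionality => z; rewrite /Z_map /= compA. Qed.

Lemma Z_map_id (X : M) : Z_map (idm X) = id.
Proof. by apply: functional_extensionality => z; apply: comp1m. Qed.

Lemma Aut_Zalg_is_group : is_group (Aut_Zalg A).
Proof.
split=> //=.
- by move=> s t _ _ e z; rewrite e.
- by move=> s t u _ _ _ e f z; rewrite e f.
- move=> s t [bs sD sZ sM s1] [bt tD tZ tM t1]; split; first exact: bij_comp.
  + by move=> z w; rewrite /= tD sD.
  + by move=> c z; rewrite /= tZ sZ.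
  + by move=> z w; rewrite /= tM sM.
  by rewrite /= t1.
- by move=> s s' t t' _ _ _ _ e f z; rewrite /= f e.
- by split=> //; exists id.
move=> s [[t sK tK] sD sZ sM s1]; exists t; split=> //; split.
- by exists s.
- by move=> z w; apply: (can_inj sK); rewrite sD !tK.
- by move=> c z; apply: (can_inj sK); rewrite sZ !tK.
- by move=> z w; apply: (can_inj sK); rewrite sM !tK.
by rewrite -[in LHS]s1 sK.
Qed.

End AlgebraAutomorphisms.

(** * Realisation of the members of [in_G] and [in_H] by automorphisms, and the group structures *)

Section Main.
Context {M : smcat} (M_abelian : is_abelian (sm_preadd M)).
Context (M_right_exact : tensor_right_exact M).
Context (M_faithful : Z_faithful M) (A : monoid M).
Context (A_azumaya : is_azumaya A) (sepA : separating A).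
Context (A_div : bimod_divides (outer_bimod A) (regular_bimod A)).
Implicit Types (a b c : Z A) (theta sigma tau : Z A -> Z A) (ga : hom (A : M) A).

Lemma twist_object_J (al be : hom (A : M) A) (X : over (A : M)) :
  twist_object al be X -> is_J (Z_map al) (Z_map be) X.
Proof.
move=> XT; apply/(is_JP M_abelian); split.
  by case: XT => -[r rK] _; apply: retraction_mono rK.
move=> T t; split=> [tP | [h <-] z].
  apply: (twist_object_factor M_faithful XT) => y a.
  by rewrite -ltri_pt -rtri_pt; congr (_ ∘ y); apply: tP.
apply: M_faithful => y; rewrite /Z_map ltri_pt rtri_pt -compA.
by apply: (proj2 (XT.2 _)); exists (h ∘ y).
Qed.

Lemma unit_J : is_J id id (Over (@mu M A)).
Proof.
have := twist_object_J (unit_twist_object M_faithful A_azumaya sepA).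
by rewrite Z_map_id.
Qed.

(** The twist objects for [ga] and for its reversal form an inverse pair, whose two pairings are
    exactly the multiplications to be inverted. *)
Lemma Z_map_in_G ga : is_monoid_aut ga -> in_G (Z_map ga).
Proof.
move=> gaA; have thA := Z_map_alg_aut gaA; have [thbij _ _ _ _] := thA.
have uth := is_J_bijective M_abelian thbij unit_J.
have idA := id_monoid_aut A.
have [X XT] := twist_object_ex M_abelian M_faithful A_azumaya sepA gaA idA.
have [Y YT] := twist_object_ex M_abelian M_faithful A_azumaya sepA idA gaA.
have [m [mV [n [nV P]]]] :=
  twist_inverse_pair M_right_exact M_faithful A_azumaya sepA A_div gaA XT YT.
have XJ := twist_object_J XT; have YJ := twist_object_J YT.
rewrite Z_map_id in XJ YJ.
case: P => _ _ mK mVK nK nVK mE nE; split=> //.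
  apply: (pair_J_mult_iso XJ YJ unit_J uth _ mE); by exists mV.
by apply: (pair_J_mult_iso YJ XJ uth unit_J _ nE); exists nV.
Qed.

(** The objects J attached to [theta] form an inverse pair. Conjugation by it satisfies ga(t) x = x
    t = theta(t) x, and x cancels. *)
Lemma in_G_realize theta : in_G theta ->
  exists ga, is_monoid_aut ga /\ theta = Z_map ga.
Proof.
move=> [[thbij _ _ _ _] G1 G2].
have uth := is_J_bijective M_abelian thbij unit_J.
have [X [XJ [Y YJ]]] : exists X, is_J theta id X /\ exists Y, is_J id theta Y.
  case: G1 => [X [Y [_ [_ [_ [_ [_ [_ [_ [_ [[XJ YJ _ _] _]]]]]]]]]]].
  by exists X; split=> //; exists Y.
have [m [[mV [mK mVK]] mE]] := J_mult_iso_pair M_abelian G1 XJ YJ unit_J uth.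
have [n [[nV [nK nVK]] nE]] := J_mult_iso_pair M_abelian G2 YJ XJ uth unit_J.
have Xm := (proj1 (is_JP M_abelian _ _ _) XJ).1.
have Ym := (proj1 (is_JP M_abelian _ _ _) YJ).1.
have P : @inverse_pair M A X Y m mV n nV by [].
have gaA := conjugation_aut M_right_exact M_faithful A_azumaya sepA A_div P.
exists (conjugation (omap X) (omap Y) mV); split=> //.
apply: functional_extensionality => t.
apply: (pair_cancel M_right_exact M_faithful A_azumaya sepA A_div P) => x.
rewrite (conjugation_left M_right_exact M_faithful A_azumaya sepA A_div P).
exact: (is_J_intertwines M_abelian).
Qed.

Lemma in_GE theta : in_G theta <-> exists ga, is_monoid_aut ga /\ theta = Z_map ga.
Proof.
split; first exact: in_G_realize.
by case=> ga [gaA ->]; apply: Z_map_in_G.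
Qed.

(** A left linear map is right multiplication by its value at 1, which turns twisting into an
    intertwining condition on one element. *)
Lemma twisted_mapE sigma tau (f : hom (A : M) A) : is_twisted_map sigma tau f ->
  (forall a, f ∘ a = a * (f ∘ mu)) /\
  (forall z, sigma z * (f ∘ mu) = (f ∘ mu) * tau z).
Proof.
move=> [fl fP]; have fE a : f ∘ a = a * (f ∘ mu).
  rewrite -[a in LHS]zmul1r -mm_pt compA fl -compA tens_pt comp1m.
  exact: mm_pt.
split=> // z; have := congr1 (fun h => h ∘ mu) (fP z).
by rewrite rtri_pt -compA rtri_pt comp1m zmul1l => <-; rewrite (fE (sigma z)).
Qed.

Lemma rtri_twisted_map sigma tau b : (forall z, sigma z * b = b * tau z) ->
  is_twisted_map sigma tau (rtri (idm (A : M)) b).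
Proof.
move=> bP; split=> [|z].
  apply: sepA => p q; rewrite -(compA _ _ (pt p q)) -(compA mm) tens_pt.
  by rewrite !mm_pt !rtri_pt !comp1m zmulA.
apply: M_faithful => a; rewrite /Z_map -compA !rtri_pt !comp1m.
by rewrite -!zmulA bP.
Qed.

Lemma twisted_divides_unit sigma tau k (b c : 'I_k -> Z A) : (1 <= k)%N ->
  (forall i z, sigma z * b i = b i * tau z) ->
  (forall i z, tau z * c i = c i * sigma z) ->
  \big[@hplus M II A/h0]_(i < k) (b i * c i) = mu ->
  twisted_divides sigma tau.
Proof.
move=> k_gt0 bP cP bc1.
exists k, (fun i => rtri (idm _) (b i)), (fun i => rtri (idm _) (c i)).
split=> // [i|i|]; try exact: rtri_twisted_map.
apply: M_faithful => a; rewrite /Z_map comp1m comp_suml -[RHS]zmul1r -bc1 zmul_sumr //.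
by apply: eq_bigr => i _; rewrite -compA !rtri_pt !comp1m zmulA.
Qed.

(** With b_i = f_i(1) and c_i = g_i(1), evaluating at 1 gives a sum of b_i c_i equal to 1, and a |->
    sum of b_i a c_i sends tau(z) to sigma(z). *)
Lemma twisted_divides_realize sigma tau : twisted_divides sigma tau ->
  exists ga, forall z, ga ∘ tau z = sigma z.
Proof.
move=> [k [f [g [_ fP gP fg1]]]].
exists (\big[@hplus M A A/h0]_(i < k)
  ltri (f i ∘ mu) (rtri (idm (A : M)) (g i ∘ mu))) => z.
have e : \big[@hplus M II A/h0]_(i < k) ((f i ∘ mu) * (g i ∘ mu)) = mu.
  rewrite -[RHS]comp1m -fg1 comp_suml; apply: eq_bigr => i _.
  by rewrite -compA -(twisted_mapE (gP i)).1.
rewrite -[sigma z]zmul1r -[mu in RHS]e zmul_sumr // comp_suml //; apply: eq_bigr => i _.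
by rewrite ltri_pt rtri_pt comp1m !zmulA (twisted_mapE (fP i)).2.
Qed.

Lemma Z_map_divides ga : is_monoid_aut ga -> twisted_divides (Z_map ga) id.
Proof.
move=> [_ gaM ga1].
have [k [b [c [k_gt0 [bP cP bc1]]]]] :=
  twisted_unit_decomposition A_azumaya sepA A_div gaM ga1.
apply: (twisted_divides_unit k_gt0 _ _ bc1) => i z.
  by rewrite -[z in RHS]comp1m; apply: bP.
by rewrite -[z in LHS]comp1m; apply: cP.
Qed.

(** The decomposition for the inverse of [ga], with its intertwining relations rewritten in terms of
    [ga]. *)
Lemma divides_Z_map ga : is_monoid_aut ga -> twisted_divides id (Z_map ga).
Proof.
move=> gaA; have [ga' [[_ ga'M ga'1] ga'K gaK']] := inverse_monoid_aut gaA.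
have [k [b [c [k_gt0 [bP cP bc1]]]]] :=
  twisted_unit_decomposition A_azumaya sepA A_div ga'M ga'1.
apply: (twisted_divides_unit k_gt0 _ _ bc1) => i z.
  have /intertwines_inverse H := bP i.
  by have := H _ ga'K gaK' z; rewrite comp1m.
have /intertwines_inverse H := cP i.
by have := H _ gaK' ga'K z; rewrite comp1m.
Qed.

Lemma in_HE theta : in_H theta <-> exists ga, is_monoid_aut ga /\ theta = Z_map ga.
Proof.
split=> [[thA d1 d2] | [ga [gaA ->]]]; last first.
  by split; [apply: Z_map_alg_aut | apply: Z_map_divides | apply: divides_Z_map].
have [[th' thK th'K] _ _ thM th1] := thA.
have [ga gaE] := twisted_divides_realize d1.
have [ga' ga'E] := twisted_divides_realize d2.
exists ga; split; last by apply: functional_extensionality => z; rewrite -gaE.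
split; last by rewrite gaE.
(* [ga] induces [theta] and [ga'] undoes [theta] on elements, so they are mutually inverse by
   faithfulness of [Z]. *)
- exists ga'; split; apply: M_faithful => z; rewrite /Z_map -compA comp1m.
    by rewrite gaE ga'E.
  by rewrite -[z]th'K ga'E gaE.
apply: sepA => a b; rewrite -(compA ga) -(compA mm) tens_pt !mm_pt !gaE.
exact: thM.
Qed.

Lemma Aut_alg_is_group : is_group (Aut_alg A).
Proof.
split=> //=.
- by move=> x y z _ _ _ -> ->.
- exact: comp_monoid_aut.
- by move=> x x' y y' _ _ _ _ -> ->.
- by move=> x y z _ _ _; apply: compA.
- exact: id_monoid_aut.
- by move=> x _; apply: comp1m.
- by move=> x _; apply: compm1.
move=> x /inverse_monoid_aut[y [yA yx xy]].
by exists y.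
Qed.

Lemma Ggroup_is_group : is_group (Ggroup A).
Proof.
split=> //=.
- by move=> s t _ _ e z; rewrite e.
- by move=> s t u _ _ _ e f z; rewrite e f.
- move=> _ _ /in_GE[g [gA ->]] /in_GE[f [fA ->]].
  by apply/in_GE; exists (g ∘ f); rewrite Z_map_comp; split=> //; apply: comp_monoid_aut.
- by move=> s s' t t' _ _ _ _ e f z; rewrite /= f e.
- by apply/in_GE; exists (idm _); rewrite Z_map_id; split=> //; apply: id_monoid_aut.
move=> _ /in_GE[g [gA ->]]; have [h [hA hg gh]] := inverse_monoid_aut gA.
exists (Z_map h); split; first by apply/in_GE; exists h.
by split=> z; rewrite /= /Z_map compA ?hg ?gh comp1m.
Qed.

Lemma inv_multP (X Y : over (A : M)) :
  is_invertible_subobject X -> is_invertible_subobject Y ->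
  is_monoid_aut (Gamma X ∘ Gamma Y) /\
  twist_object (Gamma X ∘ Gamma Y) (idm A) (inv_mult X Y).
Proof.
move=> Xi Yi.
have [XA XT] := Gamma_twist_object M_right_exact M_faithful A_azumaya sepA A_div Xi.
have [YA YT] := Gamma_twist_object M_right_exact M_faithful A_azumaya sepA A_div Yi.
split; first exact: comp_monoid_aut.
exact: inv_mult_twist_object.
Qed.

Lemma inv_mult_invertible (X Y : over (A : M)) :
  is_invertible_subobject X -> is_invertible_subobject Y ->
  is_invertible_subobject (inv_mult X Y).
Proof.
move=> Xi Yi; have [XYA XYT] := inv_multP Xi Yi.
exact: (twist_object_invertible _ _ _ _ _ _ XYA XYT).
Qed.

Lemma Inv_is_group : is_group (Inv A).
Proof.
split=> /=.
- by move=> X _; apply: over_iso_refl.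
- by move=> X Y _ _; apply: over_iso_sym.
- by move=> X Y W _ _ _; apply: over_iso_trans.
- exact: inv_mult_invertible.
- move=> X X' Y Y' _ _ _ _ [h [hi hE]] [g [gi gE]].
  exists (h ⊠ g); split; first exact: iso_tens.
  by rewrite /= -compA -tensM hE gE.
- move=> X Y W _ _ _; exists (assocV _ _ _); split.
    by exists (assoc _ _ _); rewrite assocK assocVK.
  apply: (iso_epi (f := assoc _ _ _)).
    by exists (assocV _ _ _); rewrite assocK assocVK.
  rewrite /= -compA assocK compm1.
  have -> : (mm ∘ (omap X ⊠ omap Y)) ⊠ omap W
    = (mm ⊠ idm (A : M)) ∘ ((omap X ⊠ omap Y) ⊠ omap W).
    by rewrite -tensM comp1m.
  have -> : omap X ⊠ (mm ∘ (omap Y ⊠ omap W))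
    = (idm (A : M) ⊠ mm) ∘ (omap X ⊠ (omap Y ⊠ omap W)).
    by rewrite -tensM comp1m.
  by rewrite !compA mmA -!compA assoc_nat.
(* The unit subobject is the twist object of the identity automorphism. *)
- exact: (twist_object_invertible _ _ _ _ _ _ (id_monoid_aut A)
    (unit_twist_object M_faithful A_azumaya sepA)).
- move=> X _; exists (lun _); split; first by exists (lunV _); rewrite lunK lunVK.
  by rewrite /= -lun_nat -mm1l -compA -tensM comp1m compm1.
- move=> X _; exists (run _); split; first by exists (runV _); rewrite runK runVK.
  by rewrite /= -run_nat -mm1r -compA -tensM comp1m compm1.
move=> X /inverse_pair_ex[Y [m [mV [n [nV P]]]]]; exists Y; split.
  exact: (inverse_pair_invertible (inverse_pair_sym P)).
case: P => _ _ mK mVK nK nVK mE nE; split.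
  by exists m; split=> //; exists mV.
by exists n; split=> //; exists nV.
Qed.

Lemma Gamma_over_iso (X Y : over (A : M)) :
  is_invertible_subobject X -> is_invertible_subobject Y ->
  over_iso X Y -> Gamma X = Gamma Y.
Proof.
move=> Xi Yi /over_iso_sym XY.
have [_ YT] := Gamma_twist_object M_right_exact M_faithful A_azumaya sepA A_div Yi.
apply: (Gamma_unique _ _ _ _ _ Xi) => //.
exact: (twist_object_over_iso XY YT).
Qed.

Lemma Gamma_mult (X Y : over (A : M)) :
  is_invertible_subobject X -> is_invertible_subobject Y ->
  Gamma (inv_mult X Y) = Gamma X ∘ Gamma Y.
Proof.
move=> Xi Yi; have [_ XYT] := inv_multP Xi Yi.
apply: (Gamma_unique _ _ _ _ _ (inv_mult_invertible Xi Yi)) => //.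
Qed.

Lemma Gamma_aut (X : over (A : M)) :
  is_invertible_subobject X -> is_monoid_aut (Gamma X).
Proof.
by move=> Xi;
  have [] := Gamma_twist_object M_right_exact M_faithful A_azumaya sepA A_div Xi.
Qed.

(** Injective because an invertible subobject is the twist object of its own [Gamma] and these are
    unique; surjective because every automorphism has a twist object, which is invertible. *)
Lemma Gamma_iso : @is_group_iso (Inv A) (Aut_alg A) (@Gamma M A).
Proof.
split.
- split; [exact: Inv_is_group | exact: Aut_alg_is_group | exact: Gamma_aut
         | exact: Gamma_over_iso | exact: Gamma_mult].
- move=> X Y Xi Yi /= e.
  have [_ XT] := Gamma_twist_object M_right_exact M_faithful A_azumaya sepA A_div Xi.
  have [_ YT] := Gamma_twist_object M_right_exact M_faithful A_azumaya sepA A_div Yi.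
  by rewrite e in XT; apply: (twist_object_iso M_faithful XT YT).
move=> ga gaA; have [X XT] :=
  twist_object_ex M_abelian M_faithful A_azumaya sepA gaA (id_monoid_aut A).
have Xi : is_invertible_subobject X.
  exact: (twist_object_invertible _ _ _ _ _ _ gaA XT).
exists X; split=> //=; apply: (Gamma_unique _ _ _ _ _ Xi) => //.
Qed.

Lemma omega_iso : @is_group_iso (Aut_alg A) (Ggroup A) (@omega M A).
Proof.
split.
- split; [exact: Aut_alg_is_group | exact: Ggroup_is_group | exact: Z_map_in_G | |].
    by move=> g f _ _ -> z.
  by move=> g f _ _ z; rewrite /= /omega Z_map_comp.
- by move=> g f _ _ e; apply: M_faithful.
by move=> theta /in_GE[g [gA ->]]; exists g.
Qed.

(** Agreement is asked only on members because [Phi_hat] and [omega] after [Gamma] are compared only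
    on invertible subobjects. *)
Lemma group_iso_comp (G H K : pregroup) (g : gcar H -> gcar K)
    (f : gcar G -> gcar H) (h : gcar G -> gcar K) :
  (forall x, gmem G x -> h x = g (f x)) ->
  is_group_iso g -> is_group_iso f -> is_group_iso h.
Proof.
move=> hE [[Hg Kg gm ge gmu] gi gs] [[Gg _ fm fe fmu] fi fs].
have hm x : gmem G x -> gmem K (h x) by move=> xG; rewrite hE //; apply/gm/fm.
split.
- split=> // [x y xG yG xy | x y xG yG].
    by rewrite !hE //; apply: ge; [exact: fm | exact: fm | exact: fe].
  have xyG := gmulP Gg xG yG; rewrite !hE //.
  have fxH := fm _ xG; have fyH := fm _ yG.
  apply: (geqv_trans Kg) (gmu _ _ fxH fyH).
  + exact/gm/fm.
  + exact/gm/(gmulP Hg).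
  + by apply: (gmulP Kg); apply: gm.
  apply: ge; [exact: fm | exact: (gmulP Hg) | exact: fmu].
- move=> x y xG yG; rewrite !hE // => /gi e; apply: fi => //.
  by apply: e; apply: fm.
move=> z zK; have [y [yH yz]] := gs z zK; have [x [xG xy]] := fs y yH.
exists x; split=> //; rewrite hE //.
apply: (geqv_trans Kg) yz => //; [exact/gm/fm | exact: gm |].
by apply: ge => //; apply: fm.
Qed.

End Main.

Theorem corollary4p9 (M : smcat) (M_abelian : is_abelian (sm_preadd M))
    (M_locally_small : locally_small M) (M_bicomplete : bicomplete M)
    (M_right_exact : tensor_right_exact M)
    (A : monoid M) (A_azumaya : is_azumaya A)
    (A_hom : has_left_internal_hom A)
    (A_div : bimod_divides (outer_bimod A) (regular_bimod A))
    (M_faithful : Z_faithful M) :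
  (forall theta : Z A -> Z A, in_G theta <-> in_H theta) /\
  @is_group_iso (Inv A) (Aut_alg A) (@Gamma M A) /\
  @is_group_iso (Aut_alg A) (Ggroup A) (@omega M A) /\
  @is_group_iso (Inv A) (Ggroup A) (@Phi_hat M A) /\
  @is_group_hom (Aut_alg A) (Aut_Zalg A) (@Omega M A) /\
  @is_ginjective (Aut_alg A) (Aut_Zalg A) (@Omega M A) /\
  @is_group_hom (Ggroup A) (Aut_Zalg A) (@varsigma M A) /\
  @is_group_hom (Inv A) (Aut_Zalg A) (@Phi M A) /\
  (forall X : gcar (Inv A), gmem (Inv A) X ->
     Omega (@Gamma M A X) =1 @Phi M A X) /\
  (forall X : gcar (Inv A), gmem (Inv A) X ->
     @Phi M A X =1 varsigma (@Phi_hat M A X)) /\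
  (forall gamma : gcar (Aut_alg A), gmem (Aut_alg A) gamma ->
     varsigma (@omega M A gamma) =1 @Omega M A gamma) /\
  (forall X : gcar (Inv A), gmem (Inv A) X ->
     @omega M A (@Gamma M A X) =1 @Phi_hat M A X).
Proof.
have sepA := separating_internal_hom M_faithful A_hom.
have PhiE (X : over (A : M)) : is_invertible_subobject X -> Phi X = Z_map (Gamma X).
  exact: Phi_Gamma.
have Gamma_isoA : @is_group_iso (Inv A) (Aut_alg A) (@Gamma M A).
  exact: Gamma_iso.
have omega_isoA : @is_group_iso (Aut_alg A) (Ggroup A) (@omega M A).
  exact: omega_iso.
have [[Inv_group Aut_group Gamma_mem Gamma_eqv Gamma_mul] _ _] := Gamma_isoA.
have [[_ G_group _ _ _] _ _] := omega_isoA.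
split; last split=> //; last split=> //; last split.
- move=> theta.
  have GE := in_GE M_abelian M_right_exact M_faithful A_azumaya sepA A_div theta.
  have HE := in_HE M_right_exact M_faithful A_azumaya sepA A_div theta.
  by rewrite GE HE.
- by apply: group_iso_comp omega_isoA Gamma_isoA => X; apply: PhiE.
split; last split; last split; last split; last split; last split; last split.
- split=> //; [exact: Aut_Zalg_is_group | exact: Z_map_alg_aut | |].
    by move=> g f _ _ -> z.
  by move=> g f _ _ z; rewrite /= /Omega Z_map_comp.
- by move=> g f _ _ e; apply: M_faithful.
- by split=> //; [exact: Aut_Zalg_is_group | move=> theta []].
- split=> //; first exact: Aut_Zalg_is_group.
  + by move=> X Xi; rewrite PhiE //; apply/Z_map_alg_aut/Gamma_mem.
  + by move=> X Y Xi Yi XY z; rewrite !PhiE // (Gamma_eqv _ _ Xi Yi XY).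
  move=> X Y Xi Yi z; rewrite /= !PhiE //; last exact: (gmulP Inv_group).
  by rewrite (Gamma_mul _ _ Xi Yi) Z_map_comp.
- by move=> X Xi z; rewrite PhiE.
- by [].
- by [].
by move=> X Xi z; rewrite /Phi_hat PhiE.
Qed.
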